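(* Let $\bm\alpha=(\alpha_1,\dots,\alpha_r)$ satisfy $\alpha_1>\alpha_2>\cdots>\alpha_r>-1$ and $\alpha_i-\alpha_j\notin\mathbb Z$ for $i\neq j$. Assume that for a multi-index $\bm n=(n_1,\dots,n_r)\in\mathbb N^r$ and for a specific index $i\in\{1,\dots,r\}$, $$\alpha_1-1<\alpha_i<\min_{1\le j\le r}\{\alpha_j+n_j\}-n_i+1.$$ Then the Type I multiple Laguerre polynomial of the first kind $L^{(\bm\alpha)}_{\bm n,i}$ belongs to $\mathbb P_{n_i-1}(\Delta_r)$, that is, all its zeros lie in $\Delta_r$. Additionally, for $0<t\le2$: (i) if $r$ is even, $L^{(\bm\alpha+t)}_{\bm n,i}\preccurlyeq L^{(\bm\alpha)}_{\bm n,i}$; (ii) if $r$ is odd, $L^{(\bm\alpha)}_{\bm n,i}\preccurlyeq L^{(\bm\alpha+t)}_{\bm n,i}$.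
   Context: $\mathbb N=\{1,2,\dots\}$, $|\bm n|=n_1+\dots+n_r$; $\bm\alpha+t=(\alpha_1+t,\dots,\alpha_r+t)$. Type I multiple Laguerre polynomials of the first kind: $(L^{(\bm\alpha)}_{\bm n,1},\dots,L^{(\bm\alpha)}_{\bm n,r})$ is the (unique) vector of polynomials with $\deg L^{(\bm\alpha)}_{\bm n,j}\le n_j-1$ such that $Q(x)=\sum_{j=1}^rL^{(\bm\alpha)}_{\bm n,j}(x)x^{\alpha_j}e^{-x}$ satisfies $\int_0^{+\infty}Q(x)x^k\,dx=0$ for $0\le k\le|\bm n|-2$ and $\int_0^{+\infty}Q(x)x^{|\bm n|-1}dx=1$. It is known that, up to a nonzero multiplicative constant, $$L^{(\bm\alpha)}_{\bm n,i}(x)\simeq{}_{r}F_r\left(-n_i+1,\ \alpha_i+1-\bm\alpha^{(i)}-\bm n^{(i)};\ \alpha_i+1,\ \alpha_i+1-\bm\alpha^{(i)};\ x\right),$$ where $\bm\alpha^{(i)},\bm n^{(i)}$ are obtained by deleting the $i$-th entry, scalars are added to each component, and ${}_{r}F_r$ denotes the standard (terminating) generalized hypergeometric series. Intervals: $\Delta_k=(0,+\infty)$ if $k$ is odd (including $k=1$), and $\Delta_k=(-\infty,0)$ if $k$ is even. $\mathbb P_m(K)$ denotes polynomials of degree at most $m$ with all zeros in $K$. Interlacing: for real-rooted $p,q$ with zeros $\lambda_1(p)\le\dots\le\lambda_m(p)$ and $\lambda_1(q)\le\dots\le\lambda_m(q)$ of the same degree $m$, $p\preccurlyeq q$ means $\lambda_1(p)\le\lambda_1(q)\le\lambda_2(p)\le\lambda_2(q)\le\dots\le\lambda_m(p)\le\lambda_m(q)$.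 *)

(* Defs.v *)
From HB Require Import structures.
From mathcomp Require Import all_boot all_order all_algebra.
From mathcomp Require Import all_classical all_reals all_analysis.
From mathcomp Require Import complex.

Set Implicit Arguments.
Unset Strict Implicit.
Unset Printing Implicit Defensive.

Import Order.TTheory GRing.Theory Num.Theory.

Local Open Scope classical_set_scope.
Local Open Scope ring_scope.
Local Open Scope complex_scope.

Definition Delta (R : realType) (k : nat) : interval R :=
  if odd k then `]0, +oo[ else `]-oo, 0[.

(* Polynomials of degree at most m all of whose complex zeros are real numbers
   lying in K; the zero polynomial is excluded, every complex number being a
   zero of it. *)
Definition zeros_in (R : realType) (m : nat) (K : interval R) : set {poly R} :=
  [set p : {poly R} | (size p <= m.+1)%N /\
     forall z : R[i], root (map_poly (real_complex R) p) z ->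
       exists2 x : R, x \in K & z = x%:C].

(* p is real-rooted and s lists its zeros, with multiplicity, in nondecreasing
   order. *)
Definition ordered_zeros (R : realType) (p : {poly R}) (s : seq R) : Prop :=
  [/\ p != 0, sorted <=%R s & p = lead_coef p *: \prod_(x <- s) ('X - x%:P)].

(* The ordered list of zeros is unique, so the existential quantifiers only
   name the zeros of p and q. *)
Definition interlacing (R : realType) (p q : {poly R}) : Prop :=
  exists s u : seq R,
    [/\ ordered_zeros p s, ordered_zeros q u, size s = size u,
        forall k, (k < size s)%N -> s`_k <= u`_k
      & forall k, (k.+1 < size s)%N -> u`_k <= s`_k.+1].

Definition multisize (r : nat) (n : 'I_r -> nat) : nat := (\sum_(j < r) n j)%N.

Definition shift_params (R : realType) (r : nat) (alpha : 'I_r -> R) (t : R) :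
  'I_r -> R := fun j => alpha j + t.

Definition laguerre_form (R : realType) (r : nat) (alpha : 'I_r -> R)
    (A : 'I_r -> {poly R}) (x : R) : R :=
  \sum_(j < r) (A j).[x] * (x `^ alpha j) * expR (- x).

Definition laguerre_moment (R : realType) (r : nat) (alpha : 'I_r -> R)
    (A : 'I_r -> {poly R}) (k : nat) : \bar R :=
  (\int[lebesgue_measure]_(x in `]0%R, +oo[)
     (laguerre_form alpha A x * x ^+ k)%:E)%E.

(* Entries of n are positive, so "size <= n j" means "degree <= n j - 1". *)
Definition typeI_laguerre_spec (R : realType) (r : nat) (alpha : 'I_r -> R)
    (n : 'I_r -> nat) (A : {ffun 'I_r -> {poly R}}) : Prop :=
  [/\ forall j, (size (A j) <= n j)%N,
      forall k, (k.+2 <= multisize n)%N -> laguerre_moment alpha A k = 0%E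
    & laguerre_moment alpha A (multisize n).-1 = 1%E].

(* The vector specified above; the default value 0 only matters for parameters
   for which no such vector exists. *)
Definition typeI_laguerre (R : realType) (r : nat) (alpha : 'I_r -> R)
    (n : 'I_r -> nat) : {ffun 'I_r -> {poly R}} :=
  xget [ffun=> 0] [set A | typeI_laguerre_spec alpha n A].

(* The minimum over j of alpha_j + n_j: the default element of the iterated
   minimum is itself one of the terms. *)
Definition min_sum (R : realType) (r : nat) (alpha : 'I_r.+1 -> R)
    (n : 'I_r.+1 -> nat) : R :=
  \big[Num.min/alpha ord0 + (n ord0)%:R]_(j < r.+1) (alpha j + (n j)%:R).

(* Main.v *)
Require Import Defs.
From mathcomp Require Import all_boot all_order all_algebra.
From mathcomp Require Import polyrcf.
From mathcomp Require Import all_classical all_reals all_analysis.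
From mathcomp Require Import measurable_realfun complex.
From mathcomp Require Import ring lra zify.

(* The vanishing moments say that the functional f |-> sum_(j, k) b_(j,k) f(alpha_j + k + 1),
   with b_(j,k) = Gamma(alpha_j + k + 1) * (k-th coefficient of A_j), kills the polynomials
   of degree < |n| - 1 and is 1 on the monic ones of degree |n| - 1: it is the divided
   difference at the nodes alpha_j + k + 1, which gives the coefficients explicitly.  Thus,
   up to x |-> (-1)^r x and a constant, A_i is obtained from the Laguerre polynomial of
   degree n_i - 1 and parameter alpha_i by multiplying the k-th coefficient by the product
   over j <> i of e(e-1)...(e-k+1) / (c(c+1)...(c+k-1)), where c = alpha_i - alpha_j + 1 > 0
   and e = n_j - c > n_i - 2.

   On polynomials of degree m with nonnegative zeros, multiplying the k-th coefficient by
   k + b (b > 0) or b - k (b > m) preserves real-rootedness and interlacing: this is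
   p |-> b p + x p' or b p - x p', and at a zero of the image of p the sign of the image of
   q is that of the Wronskian of the pair.  The sequences 1 / (c)_k and e(e-1)...(e-k+1)
   are limits of products of such factors, and weak interlacing is closed under limits.
   It remains to see that the Laguerre polynomials of parameters alpha and alpha + t
   interlace for 0 < t <= 2: zeros increase with the parameter, and t = 2 follows from the
   contiguous relations. *)

Set Implicit Arguments.
Unset Strict Implicit.
Unset Printing Implicit Defensive.

Import Order.TTheory GRing.Theory Num.Theory.
Import numFieldNormedType.Exports.

Local Open Scope classical_set_scope.
Local Open Scope ring_scope.

(** * Polynomials with prescribed real roots *)

Definition root_prod (R : realType) (m : nat) (s : nat -> R) : {poly R} :=
  \prod_(k < m) ('X - (s k)%:P).

(** Roots are given by a total function of which only the values below [m] count. Nonvanishing of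
    the coefficient of index [m] fixes the degree and is easy to carry through coefficientwise
    limits. *)
Definition splits (R : realType) (m : nat) (p : {poly R}) (s : nat -> R) : Prop :=
  p`_m != 0 /\ p = p`_m *: root_prod m s.

Section RootProd.
Variable R : realType.
Implicit Types (m : nat) (s u : nat -> R) (p q f : {poly R}).

Lemma root_prodE m s : root_prod m s = \prod_(x <- mkseq s m) ('X - x%:P).
Proof. rewrite /root_prod /mkseq big_map.
by rewrite -(big_mkord xpredT (fun k => 'X - (s k)%:P)) /index_iota subn0.  Qed.

Lemma size_root_prod m s : size (root_prod m s) = m.+1.
Proof. by rewrite root_prodE size_prod_XsubC size_mkseq. Qed.

Lemma coef_root_prod_top m s : (root_prod m s)`_m = 1.
Proof.
have /monicP := monic_prod_XsubC (mkseq s m) xpredT id.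
by rewrite -root_prodE lead_coefE size_root_prod.
Qed.

Lemma horner_root_prod m s x : (root_prod m s).[x] = \prod_(k < m) (x - s k).
Proof. by rewrite /root_prod horner_prod; apply: eq_bigr => k _; rewrite !hornerE. Qed.

Lemma root_prod_root m s k : (k < m)%N -> (root_prod m s).[s k] = 0.
Proof.
by move=> km; rewrite horner_root_prod (bigD1 (Ordinal km)) //= subrr mul0r.
Qed.

Lemma root_prodS m s : root_prod m.+1 s = root_prod m s * ('X - (s m)%:P).
Proof. by rewrite /root_prod big_ord_recr. Qed.

Lemma eq_root_prod m s u : (forall k, (k < m)%N -> s k = u k) ->
  root_prod m s = root_prod m u.
Proof. by move=> su; apply: eq_bigr => k _; rewrite su. Qed.

Lemma splits_root_prod m s c : c != 0 -> splits m (c *: root_prod m s) s.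
Proof. by move=> c0; rewrite /splits coefZ coef_root_prod_top mulr1. Qed.

Lemma splits_size m p s : splits m p s -> size p = m.+1.
Proof. by move=> [p0 ->]; rewrite size_scale // size_root_prod. Qed.

Lemma splits_scale m p s c : c != 0 -> splits m p s -> splits m (c *: p) s.
Proof.
move=> c0 [p0 pE]; split; first by rewrite coefZ mulf_neq0.
by rewrite coefZ -scalerA -pE.
Qed.

Lemma splits_root m p s k : splits m p s -> (k < m)%N -> p.[s k] = 0.
Proof.
by move=> [_ ->] km; rewrite hornerZ root_prod_root ?mulr0.
Qed.

Lemma ltr_step m s : (forall k, (k.+1 < m)%N -> s k < s k.+1) ->
  forall j k, (j < k)%N -> (k < m)%N -> s j < s k.
Proof.
move=> inc j; elim=> // k IH; rewrite ltnS leq_eqVlt => /predU1P[->|jk] km.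
  exact: inc.
by apply: lt_trans (inc _ km); apply: IH => //; apply: ltnW.
Qed.

Lemma ler_step m s : (forall k, (k.+1 < m)%N -> s k <= s k.+1) ->
  forall j k, (j <= k)%N -> (k < m)%N -> s j <= s k.
Proof.
move=> inc j; elim=> [|k IH]; first by rewrite leqn0 => /eqP->.
rewrite leq_eqVlt => /predU1P[->//|jk] km.
by apply: le_trans (inc _ km); apply: IH => //; apply: ltnW.
Qed.

(** Unique factorization makes the two lists permutations of each other, and sorting removes the
    freedom. This allows chaining relations whose root sequences come from separate existentials. *)
Lemma splits_inj m p s u : splits m p s -> splits m p u ->
  (forall k, (k.+1 < m)%N -> s k <= s k.+1) ->
  (forall k, (k.+1 < m)%N -> u k <= u k.+1) ->
  forall k, (k < m)%N -> s k = u k.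
Proof.
move=> [p0 pE] [_ pE'] sinc uinc k km.
have /eqP : root_prod m s = root_prod m u.
  by apply: (scalerI p0); rewrite -pE.
rewrite !root_prodE; move=> /eqP/prod_XsubC_eq ps.
have so (t : nat -> R) : (forall k, (k.+1 < m)%N -> t k <= t k.+1) -> sorted <=%R (mkseq t m).
  move=> tinc; apply/(sortedP 0) => i; rewrite size_mkseq => im.
  by rewrite !nth_mkseq //; [exact: tinc | exact: ltnW].
have := sorted_eq le_trans le_anti (so _ sinc) (so _ uinc) ps.
by move=> /(congr1 (fun t => t`_k)); rewrite !nth_mkseq.
Qed.

(** There are [m - j] negative factors; the exponent [m + j] has the same parity and avoids
    truncated subtraction. *)
Lemma sgr_prod_lt m j (d : nat -> R) : (j <= m)%N ->
  (forall k, (k < j)%N -> 0 < d k) ->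
  (forall k, (j <= k < m)%N -> d k < 0) ->
  0 < (-1) ^+ (m + j) * \prod_(k < m) d k.
Proof.
elim: m => [|m IH] jm dpos dneg.
  by move: jm; rewrite leqn0 => /eqP ->; rewrite big_ord0 mulr1 expr0.
move: jm; rewrite leq_eqVlt => /predU1P[jE|jm].
  rewrite jE -signr_odd addnn odd_double mul1r.
  by apply: prodr_gt0 => k _; apply: dpos; rewrite jE.
rewrite big_ord_recr /= addSn exprS mulN1r mulNr mulrA -mulrN.
apply: mulr_gt0; last by rewrite oppr_gt0 dneg // -ltnS jm /=.
apply: IH => // k /andP[jk km]; apply: dneg; rewrite jk /=; exact: ltnW.
Qed.

Lemma poly_eq0_roots m f (x : nat -> R) : (size f <= m)%N ->
  (forall k, (k.+1 < m)%N -> x k < x k.+1) ->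
  (forall k, (k < m)%N -> f.[x k] = 0) -> f = 0.
Proof.
move=> sf xinc xroot; apply: (@roots_geq_poly_eq0 _ _ (mkseq x m)).
- by apply/allP => _ /mapP[k + ->]; rewrite mem_iota => km; apply/rootP/xroot.
- apply: lt_sorted_uniq; apply/(sortedP 0) => i; rewrite size_mkseq => im.
  by rewrite !nth_mkseq //; [exact: xinc | exact: ltnW].
- by rewrite size_mkseq.
Qed.

Lemma splits_of_roots m f (x : nat -> R) : (size f <= m.+1)%N -> f != 0 ->
  (forall k, (k.+1 < m)%N -> x k < x k.+1) ->
  (forall k, (k < m)%N -> f.[x k] = 0) -> splits m f x.
Proof.
move=> sf f0 xinc xroot.
have fm : f`_m != 0.
  apply: contraNN f0 => /eqP fm; apply/eqP; apply: poly_eq0_roots xinc xroot.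
  by rewrite -ltnS ltn_neqAle sf andbT; apply/eqP => szf;
    have := lead_coef_eq0 f; rewrite lead_coefE szf /= fm eqxx => /esym/eqP f00;
    move: szf; rewrite f00 size_poly0.
split=> //; apply/eqP; rewrite -subr_eq0; apply/eqP.
apply: poly_eq0_roots xinc _ => [|k km]; last first.
  by rewrite hornerD hornerN hornerZ root_prod_root ?xroot // mulr0 subr0.
apply/leq_sizeP => j; rewrite leq_eqVlt => /predU1P[<-|mj].
  by rewrite coefB coefZ coef_root_prod_top mulr1 subrr.
rewrite coefB coefZ [f`_j]nth_default; last exact: leq_trans mj.
by rewrite [X in _ * X]nth_default ?size_root_prod // mulr0 subr0.
Qed.

(** The intermediate value theorem gives a root in each of the [m] gaps, which exhausts the
    degree. *)
Lemma splits_alternating m f (x : nat -> R) : (size f <= m.+1)%N ->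
  (forall k, (k < m)%N -> x k < x k.+1) ->
  (forall k, (k <= m)%N -> 0 < (-1) ^+ (m + k) * f.[x k]) ->
  exists2 u, splits m f u & forall k, (k < m)%N -> x k < u k < x k.+1.
Proof.
move=> sf xinc alt.
have /choice[u Hu] : forall k, exists y, (k < m)%N -> (x k < y < x k.+1) /\ f.[y] = 0.
  move=> k; have [km|//] := ltnP k m; last by exists 0.
  have := mulr_gt0 (alt _ (ltnW km)) (alt _ km).
  rewrite addnS exprS mulN1r mulNr mulrN oppr_gt0 mulrACA -expr2 -exprM.
  rewrite -signr_odd oddM andbF mul1r => fs.
  have [y yI /rootP fy] := poly_ivtoo (ltW (xinc _ km)) fs.
  by exists y => _; rewrite fy; split=> //; move: yI; rewrite in_itv.
exists u; last by move=> k /Hu[].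
apply: splits_of_roots => // [|k km|k /Hu[]//].
  apply/eqP => f0; have := alt 0%N isT.
  by rewrite f0 horner0 mulr0 ltxx.
have [/andP[_ a] _] := Hu _ (ltnW km); have [/andP[b _] _] := Hu _ km.
exact: lt_trans a b.
Qed.

Lemma poly_large_pos m f : (size f <= m.+1)%N -> 0 < f`_m ->
  forall a, exists2 x, a < x & 0 < f.[x].
Proof.
move=> sf fm a.
have lf : lead_coef f = f`_m.
  rewrite lead_coefE; suff -> : size f = m.+1 by [].
  apply/eqP; rewrite eqn_leq sf ltnNge; apply/negP => sf'.
  by move: fm; rewrite nth_default // ltxx.
have lf0 : 0 < lead_coef f by rewrite lf.
have [y Hy] := poly_pinfty_gt_lc lf0.
exists (Num.max y (a + 1)).
  by rewrite lt_max ltrDl ltr01 orbT.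
by apply: lt_le_trans lf0 (Hy _ _); rewrite le_max lexx.
Qed.

(** The last sign change lies beyond the last point: the positive top coefficient decides the sign
    at a large argument. *)
Lemma splits_alternating_top m f (x : nat -> R) : (size f <= m.+1)%N -> 0 < f`_m ->
  (forall k, (k.+1 < m)%N -> x k < x k.+1) ->
  (forall k, (k < m)%N -> 0 < (-1) ^+ (m + k) * f.[x k]) ->
  exists u, [/\ splits m f u, forall k, (k < m)%N -> x k < u k
    & forall k, (k.+1 < m)%N -> u k < x k.+1].
Proof.
move=> sf fm xinc alt; have [y xy fy] := poly_large_pos sf fm (x m.-1).
have [|k km|u Hu xu] := @splits_alternating m f (fun k => if (k < m)%N then x k else y) sf.
- move=> k km; rewrite km; case: ltnP => [|mk]; first exact: xinc.
  have -> : k = m.-1 by case: (m) km mk => // m' km mk; apply/anti_leq/andP.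
  exact: xy.
- case: ltnP => [|mk]; first exact: alt.
  have -> : k = m by apply/eqP; rewrite eqn_leq km mk.
  by rewrite addnn -signr_odd odd_double mul1r.
exists u; split=> // k km; first by have := xu k km; rewrite km => /andP[].
by have := xu k (ltnW km); rewrite km => /andP[].
Qed.

End RootProd.

(** * The operators [p |-> c p + d x p'] *)

Definition euler (R : realType) (c d : R) (p : {poly R}) : {poly R} :=
  c *: p + d *: ('X * p^`()).

Definition strictly_interlaced (R : realType) (m : nat) (p q : {poly R}) : Prop :=
  exists s u : nat -> R, [/\ splits m p s, splits m q u,
    forall k, (k < m)%N -> 0 < s k < u k
    & forall k, (k.+1 < m)%N -> u k < s k.+1].

Section Euler.
Variable R : realType.
Implicit Types (m : nat) (s u : nat -> R) (p q f : {poly R}).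

Lemma coef_euler c d p k : (euler c d p)`_k = (c + d * k%:R) * p`_k.
Proof.
rewrite coefD !coefZ coefXM; case: k => [|k] /=; first by rewrite !mulr0; ring.
by rewrite coef_deriv -mulr_natr; ring.
Qed.

Lemma horner_euler c d p x : (euler c d p).[x] = c * p.[x] + d * (x * p^`().[x]).
Proof. by rewrite /euler !hornerE. Qed.

Lemma size_euler c d m p : (size p <= m)%N -> (size (euler c d p) <= m)%N.
Proof.
move=> sp; apply/leq_sizeP => j mj.
by rewrite coef_euler nth_default ?mulr0 //; apply: leq_trans mj.
Qed.

Lemma deriv_root_prodE m s k : (k < m)%N ->
  (root_prod m s)^`().[s k] = \prod_(i < m | i != k :> nat) (s k - s i).
Proof.
move=> km; rewrite /root_prod (bigD1 (Ordinal km)) //= derivM derivXsubC mul1r !hornerE.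
by rewrite subrr mul0r addr0 horner_prod; apply: eq_bigr => i _; rewrite !hornerE.
Qed.

Lemma sgr_deriv_root_prod m s k :
  (forall k, (k.+1 < m)%N -> s k < s k.+1) -> (k < m)%N ->
  0 < (-1) ^+ (m + k.+1) * (root_prod m s)^`().[s k].
Proof.
move=> /ltr_step sinc km; rewrite deriv_root_prodE // big_mkcond /=.
apply: (sgr_prod_lt (d := fun i => if i != k then s k - s i else 1)) => // i.
  by rewrite ltnS leq_eqVlt; case: eqP => //= _ ik; rewrite subr_gt0; apply: sinc.
by case: eqP => /= [->|_ /andP[ki im]]; [lia | rewrite subr_lt0; apply: sinc].
Qed.

Lemma sgr_root_prod m s k x : (k <= m)%N ->
  (forall i, (i < k)%N -> s i < x) -> (forall i, (k <= i < m)%N -> x < s i) ->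
  0 < (-1) ^+ (m + k) * (root_prod m s).[x].
Proof.
move=> km lo hi; rewrite horner_root_prod.
apply: (sgr_prod_lt (d := fun i => x - s i)) => // i ik.
  by rewrite subr_gt0 lo.
by rewrite subr_lt0 hi.
Qed.

(* By Lagrange interpolation [q = p + \sum_k r_k p / ('X - s_k)] with [r_k < 0],
   and each summand contributes [- r_k (p / ('X - s_k))^2] to the Wronskian. *)
Lemma wronskian_gt0 m s u x : (0 < m)%N ->
  (forall k, (k < m)%N -> s k < u k) -> (forall k, (k.+1 < m)%N -> u k < s k.+1) ->
  (root_prod m s).[x] != 0 ->
  0 < (root_prod m u)^`().[x] * (root_prod m s).[x]
      - (root_prod m u).[x] * (root_prod m s)^`().[x].
Proof.
move=> m0 su us; set p := root_prod m s; set q := root_prod m u => px.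
have sinc k : (k.+1 < m)%N -> s k < s k.+1.
  by move=> km; apply: lt_trans (us _ km); apply/su/ltnW.
have uinc k : (k.+1 < m)%N -> u k < u k.+1.
  by move=> km; apply: lt_trans (us _ km) _; apply: su.
have slt := ltr_step sinc; have ult := ltr_step uinc.
pose pk (k : 'I_m) : {poly R} := \prod_(i < m | i != k) ('X - (s i)%:P).
have pE (k : 'I_m) : p = ('X - (s k)%:P) * pk k by rewrite /p /root_prod (bigD1 k).
have pkE (k : 'I_m) : (pk k).[s k] = p^`().[s k].
  by rewrite (pE k) derivM derivXsubC mul1r !hornerE subrr mul0r addr0.
have sg (k : 'I_m) : q.[s k] / (pk k).[s k] < 0.
  rewrite pkE; have := sgr_deriv_root_prod sinc (ltn_ord k); rewrite -/p => dp.
  have := @sgr_root_prod m u k (s k) (ltnW (ltn_ord k)).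
  rewrite -/q => qs; have {}qs : 0 < (-1) ^+ (m + k) * q.[s k].
    apply: qs => i.
      move=> ik; apply: (lt_le_trans (us i _)); first by have := ltn_ord k; lia.
      by apply: (ler_step (m := m)) => // j jm; exact/ltW/sinc.
    move=> /andP[ki im]; apply: (lt_le_trans (su k _)) => //.
    by apply: (ler_step (m := m)) => // j jm; exact/ltW/uinc.
  move: dp qs; rewrite addnS exprS; set e := (-1) ^+ _.
  have e2 : e * e = 1 :> R by rewrite /e -expr2 sqrr_sign.
  move=> dp qs; have := divr_gt0 qs dp.
  have e0 : e != 0 by rewrite signr_eq0.
  have p0 : p^`().[s k] != 0.
    by apply: contraTneq dp => ->; rewrite mulr0 ltxx.
  suff -> : e * q.[s k] / (-1 * e * p^`().[s k]) = - (q.[s k] / p^`().[s k]).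
    by rewrite oppr_gt0.
  by field; rewrite p0 e0.
pose r (k : 'I_m) := q.[s k] / (pk k).[s k].
have qE : q = p + \sum_k r k *: pk k.
  apply/eqP; rewrite -subr_eq0 opprD addrA; apply/eqP.
  have szpk (k : 'I_m) : (size (pk k) <= m)%N.
    have p0 : p != 0 by rewrite -size_poly_eq0 /p size_root_prod.
    have pk0 : pk k != 0 by apply: contraNneq p0 => pk0; rewrite (pE k) pk0 mulr0.
    by have := size_root_prod m s; rewrite -/p (pE k) (size_monicM (monicXsubC _) pk0) size_XsubC add2n => -[->].
  apply: (poly_eq0_roots (m := m)) sinc _ => [|k km].
    apply/leq_sizeP => j mj; rewrite !coefB coef_sum big1 ?subr0 => [|k _]; last first.
      by rewrite coefZ nth_default ?mulr0 //; apply: leq_trans mj.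
    move: mj; rewrite leq_eqVlt => /predU1P[<-|mj].
      by rewrite !coef_root_prod_top subrr.
    by rewrite !nth_default ?subrr // size_root_prod.
  rewrite !hornerE horner_sum (bigD1 (Ordinal km)) //= big1 => [|i ik].
    have pkk : (pk (Ordinal km)).[s k] != 0.
      have := sg (Ordinal km); apply: contraTneq => ->.
      by rewrite invr0 mulr0 ltxx.
    by rewrite root_prod_root // hornerZ /r /= divfK // subr0 addr0 subrr.
  rewrite hornerZ /pk horner_prod (bigD1 (Ordinal km)) /=; last by rewrite eq_sym.
  by rewrite hornerXsubC subrr mul0r mulr0.
rewrite qE derivD linear_sum !hornerD !horner_sum mulrDl mulrDl opprD.
rewrite addrACA [X in X - _ + _]mulrC subrr add0r !mulr_suml -sumrB.
have term (k : 'I_m) : (r k *: pk k)^`().[x] * p.[x] - (r k *: pk k).[x] * p^`().[x]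
    = - r k * (pk k).[x] ^+ 2.
  by rewrite derivZ !hornerZ (pE k) derivM derivXsubC mul1r hornerD !hornerM hornerXsubC; ring.
rewrite (eq_bigr _ (fun k _ => term k)) (bigD1 (Ordinal m0)) //=.
(* All summands are nonnegative; one of them, that of index 0, is shown to be positive because [p]
   does not vanish at [x]. *)
apply: ltr_wpDr.
  by apply: sumr_ge0 => k _; rewrite mulr_ge0 ?sqr_ge0 // oppr_ge0; exact/ltW/sg.
rewrite mulr_gt0 ?oppr_gt0 ?[r _ < 0]sg // exprn_even_gt0 //=.
by apply: contraNneq px => pk0; rewrite (pE (Ordinal m0)) hornerM pk0 mulr0.
Qed.

(** At 0 the image has the sign of [p(0)] and at [s k] that of [p'(s k)], so it alternates along the
    [m + 1] points [0, s 0, ..., s (m - 1)]. *)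
Lemma euler_up_splits m s b : 0 < b ->
  (forall k, (k < m)%N -> 0 < s k) -> (forall k, (k.+1 < m)%N -> s k < s k.+1) ->
  exists v, [/\ splits m (euler b 1 (root_prod m s)) v,
    forall k, (k < m)%N -> 0 < v k < s k & forall k, (k.+1 < m)%N -> s k < v k.+1].
Proof.
move=> b0 spos sinc; set p := root_prod m s.
have [|k km|k km|v Hv xv] := @splits_alternating R m (euler b 1 p)
    (fun k => if k is k'.+1 then s k' else 0).
- by apply: size_euler; rewrite size_root_prod.
- by case: k km => [|k] km; [exact: spos | exact: sinc].
- rewrite horner_euler; case: k km => [|k] km.
    rewrite mul0r mulr0 addr0 mulrCA mulr_gt0 //.
    by apply: sgr_root_prod => // i /andP[_ im]; exact: spos.
  rewrite root_prod_root // mulr0 add0r mul1r.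
  by rewrite mulrCA mulr_gt0 ?spos // sgr_deriv_root_prod.
exists v; split=> // k km; last by have /andP[] := xv _ km.
have /andP[xk ->] := xv _ km; rewrite andbT.
by case: k km xk => // k km; apply: lt_trans; apply/spos/ltnW.
Qed.

(** At [s k] the image equals [- s k * p'(s k)], and its top coefficient is [b - m > 0]: one root in
    each gap and one beyond the last [s k]. *)
Lemma euler_dn_splits m s b : m%:R < b ->
  (forall k, (k < m)%N -> 0 < s k) -> (forall k, (k.+1 < m)%N -> s k < s k.+1) ->
  exists v, [/\ splits m (euler b (-1) (root_prod m s)) v,
    forall k, (k < m)%N -> s k < v k & forall k, (k.+1 < m)%N -> v k < s k.+1].
Proof.
move=> bm spos sinc; set p := root_prod m s.
apply: splits_alternating_top => //.
- by apply: size_euler; rewrite size_root_prod.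
- by rewrite coef_euler coef_root_prod_top; lra.
- move=> k km; rewrite horner_euler root_prod_root //.
  have := mulr_gt0 (spos _ km) (sgr_deriv_root_prod sinc km).
  by rewrite -/p addnS exprS; set e := _ ^+ _; set y := p^`().[_]; lra.
Qed.

(** The roots of the image are separated by the [s k], which fixes the sign of [p] at each of them.
    A polynomial [f] with the sign of [p] there alternates, hence has its own roots between them. *)
Lemma interlaced_euler_up m s b f : 0 < b ->
  (forall k, (k < m)%N -> 0 < s k) -> (forall k, (k.+1 < m)%N -> s k < s k.+1) ->
  (size f <= m.+1)%N -> 0 < f`_m ->
  (forall x, (0 < m)%N -> 0 < x -> (root_prod m s).[x] != 0 ->
    (euler b 1 (root_prod m s)).[x] = 0 -> 0 < f.[x] * (root_prod m s).[x]) ->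
  strictly_interlaced m (euler b 1 (root_prod m s)) f.
Proof.
move=> b0 spos sinc sf fm fpos.
have [v [Hv vs sv]] := euler_up_splits b0 spos sinc.
have vinc k : (k.+1 < m)%N -> v k < v k.+1.
  by move=> km; apply: lt_trans (sv _ km); have /andP[] := vs _ (ltnW km).
have sgp k : (k < m)%N -> 0 < (-1) ^+ (m + k) * (root_prod m s).[v k].
  move=> km; apply: sgr_root_prod => [|i ik|i /andP[ki im]]; first exact: ltnW.
    apply: lt_le_trans (sv i _) _; first by lia.
    by apply: (ler_step (m := m)) => // j /vinc/ltW.
  have /andP[_ vk] := vs _ km; apply: lt_le_trans vk _.
  by apply: (ler_step (m := m)) => // j /sinc/ltW.
have [k km|u [Hu vu uv]] := splits_alternating_top sf fm vinc.
  have sk := sgp _ km.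
  have p0 : (root_prod m s).[v k] != 0.
    by apply: contraTneq sk => ->; rewrite mulr0 ltxx.
  have /andP[v0 _] := vs _ km.
  have := mulr_gt0 (fpos _ (leq_ltn_trans (leq0n k) km) v0 p0 (splits_root Hv km)) sk.
  by rewrite mulrCA -mulrA -expr2 mulrA pmulr_lgt0 // exprn_even_gt0.
exists v, u; split=> // k km; have /andP[-> _] := vs _ km; exact: vu.
Qed.

(** The roots of the image now lie to the right of the [s k], so [f] has to take the sign opposite
    to that of [p]. *)
Lemma interlaced_euler_dn m s b f : m%:R < b ->
  (forall k, (k < m)%N -> 0 < s k) -> (forall k, (k.+1 < m)%N -> s k < s k.+1) ->
  (size f <= m.+1)%N -> 0 < f`_m ->
  (forall x, (0 < m)%N -> 0 < x -> (root_prod m s).[x] != 0 ->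
    (euler b (-1) (root_prod m s)).[x] = 0 -> f.[x] * (root_prod m s).[x] < 0) ->
  strictly_interlaced m (euler b (-1) (root_prod m s)) f.
Proof.
move=> bm spos sinc sf fm fneg.
have [v [Hv sv vs]] := euler_dn_splits bm spos sinc.
have vinc k : (k.+1 < m)%N -> v k < v k.+1.
  by move=> km; apply: lt_trans (vs _ km) (sv _ km).
have sgp k : (k < m)%N -> 0 < (-1) ^+ (m + k.+1) * (root_prod m s).[v k].
  move=> km; apply: sgr_root_prod => [|i ik|i /andP[ki im]] //.
    apply: lt_le_trans (sv i _) _; first by lia.
    by apply: (ler_step (m := m)) => // j /vinc/ltW.
  apply: lt_le_trans (vs _ _) _; first by lia.
  by apply: (ler_step (m := m)) => // j /sinc/ltW.
have v0 k : (k < m)%N -> 0 < v k by move=> km; exact: lt_trans (spos _ km) (sv _ km).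
have [k km|u [Hu vu uv]] := splits_alternating_top sf fm vinc.
  have sk := sgp _ km.
  have p0 : (root_prod m s).[v k] != 0.
    by apply: contraTneq sk => ->; rewrite mulr0 ltxx.
  have := fneg _ (leq_ltn_trans (leq0n k) km) (v0 _ km) p0 (splits_root Hv km).
  rewrite -oppr_gt0 => fp; have := mulr_gt0 fp sk.
  rewrite addnS exprS !mulN1r !mulNr mulrN opprK mulrCA -mulrA -expr2 mulrA.
  by rewrite pmulr_lgt0 // exprn_even_gt0.
by exists v, u; split=> // k km; rewrite v0 //; exact: vu.
Qed.

(** At a zero of [b p + x p'] one has [(b q + x q') p = x (q' p - q p')], positive by
    [wronskian_gt0]. *)
Lemma euler_up_interlaced m s u b : 0 < b ->
  (forall k, (k < m)%N -> 0 < s k < u k) -> (forall k, (k.+1 < m)%N -> u k < s k.+1) ->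
  strictly_interlaced m (euler b 1 (root_prod m s)) (euler b 1 (root_prod m u)).
Proof.
move=> b0 su us; apply: interlaced_euler_up => //.
- by move=> k /su/andP[].
- by move=> k km; apply: lt_trans (us _ km); have /andP[] := su _ (ltnW km).
- by apply: size_euler; rewrite size_root_prod.
- by rewrite coef_euler coef_root_prod_top mulr1 mul1r ltr_pwDl.
move=> x m0 x0 px; rewrite !horner_euler => /eqP; rewrite mul1r addr_eq0 => /eqP rx.
have := mulr_gt0 x0 (wronskian_gt0 m0 (fun k km => proj2 (andP (su k km))) us px).
by congr (0 < _); rewrite mulrDl mulrAC rx; ring.
Qed.

(** At a zero of [b p - x p'] one has [(b q - x q') p = - x (q' p - q p')]. *)
Lemma euler_dn_interlaced m s u b : m%:R < b ->
  (forall k, (k < m)%N -> 0 < s k < u k) -> (forall k, (k.+1 < m)%N -> u k < s k.+1) ->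
  strictly_interlaced m (euler b (-1) (root_prod m s)) (euler b (-1) (root_prod m u)).
Proof.
move=> bm su us; apply: interlaced_euler_dn => //.
- by move=> k /su/andP[].
- by move=> k km; apply: lt_trans (us _ km); have /andP[] := su _ (ltnW km).
- by apply: size_euler; rewrite size_root_prod.
- by rewrite coef_euler coef_root_prod_top; lra.
move=> x m0 x0 px; rewrite !horner_euler => /eqP; rewrite mulN1r subr_eq0 => /eqP rx.
have := mulr_gt0 x0 (wronskian_gt0 m0 (fun k km => proj2 (andP (su k km))) us px).
by rewrite -oppr_lt0; congr (_ < 0); rewrite mulrDl mulrAC rx; ring.
Qed.

(** At a zero of [b p + x p'] one has [(b' p + x p') p = (b' - b) p^2]. *)
Lemma euler_up_mono m s b b' : 0 < b -> b < b' ->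
  (forall k, (k < m)%N -> 0 < s k) -> (forall k, (k.+1 < m)%N -> s k < s k.+1) ->
  strictly_interlaced m (euler b 1 (root_prod m s)) (euler b' 1 (root_prod m s)).
Proof.
move=> b0 bb' spos sinc; apply: interlaced_euler_up => //.
- by apply: size_euler; rewrite size_root_prod.
- by rewrite coef_euler coef_root_prod_top mulr1 mul1r ltr_pwDl // (lt_trans b0).
move=> x m0 x0 px; rewrite !horner_euler !mul1r => /eqP; rewrite addrC addr_eq0 => /eqP ->.
rewrite -mulrBl -mulrA -expr2 mulr_gt0 ?subr_gt0 //.
by rewrite exprn_even_gt0.
Qed.

End Euler.

(** * Limits of interlacing pairs *)

(** Unlike interlacing, this comparison of [k]-th roots is transitive; it does not imply that the
    roots are sorted, so that is recorded separately. *)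
Definition dominated (R : realType) (m : nat) (p q : {poly R}) : Prop :=
  exists s u : nat -> R, [/\ splits m p s, splits m q u,
    forall k, (k < m)%N -> 0 <= s k <= u k,
    forall k, (k.+1 < m)%N -> s k <= s k.+1
    & forall k, (k.+1 < m)%N -> u k <= u k.+1].

Definition interlaced (R : realType) (m : nat) (p q : {poly R}) : Prop :=
  exists s u : nat -> R, [/\ splits m p s, splits m q u,
    forall k, (k < m)%N -> 0 <= s k <= u k
    & forall k, (k.+1 < m)%N -> u k <= s k.+1].

Section Limits.
Variable R : realType.
Implicit Types (m : nat) (s u : nat -> R) (p q : {poly R}).

Lemma interlaced_dominated m p q : interlaced m p q -> dominated m p q.
Proof.
move=> [s [u [Hs Hu su us]]]; exists s, u; split=> // k km.
  by apply: le_trans (us _ km); have /andP[] := su _ (ltnW km).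
by apply: le_trans (us _ km) _; have /andP[] := su _ km.
Qed.

Lemma strictly_interlacedW m p q : strictly_interlaced m p q -> interlaced m p q.
Proof.
move=> [s [u [Hs Hu su us]]]; exists s, u; split=> // k km.
  by have /andP[/ltW -> /ltW ->] := su _ km.
exact/ltW/us.
Qed.

Lemma interlaced_scale m p q a b : a != 0 -> b != 0 ->
  interlaced m p q -> interlaced m (a *: p) (b *: q).
Proof. by move=> a0 b0 [s [u [Hs Hu *]]]; exists s, u; split=> //; exact: splits_scale. Qed.

Lemma dominated_scale m p q a b : a != 0 -> b != 0 ->
  dominated m p q -> dominated m (a *: p) (b *: q).
Proof. by move=> a0 b0 [s [u [Hs Hu *]]]; exists s, u; split=> //; exact: splits_scale. Qed.

Lemma dominated_trans m p q f : dominated m p q -> dominated m q f -> dominated m p f.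
Proof.
move=> [s [u [Hs Hu su sinc uinc]]] [v [w [Hv Hw vw vinc winc]]].
exists s, w; split=> // k km; have /andP[-> le1] := su _ km.
have /andP[_] := vw _ km; apply: le_trans; apply: le_trans le1 _.
by rewrite (splits_inj Hu Hv uinc vinc km).
Qed.

Lemma interlaced_refl m p s : splits m p s -> (forall k, (k < m)%N -> 0 <= s k) ->
  (forall k, (k.+1 < m)%N -> s k <= s k.+1) -> interlaced m p p.
Proof. by move=> Hs s0 sinc; exists s, s; split=> // k /s0 ->/=. Qed.

Lemma coef_root_prodS m s j : (root_prod m.+1 s)`_j =
  (if j is j'.+1 then (root_prod m s)`_j' else 0) - s m * (root_prod m s)`_j.
Proof. by rewrite root_prodS mulrBr coefB coefMX coefMC mulrC; case: j. Qed.

Lemma cvg_coef_root_prod (F : set_system nat) {FF : Filter F} m (S : nat -> nat -> R) s :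
  (forall k, (k < m)%N -> S M k @[M --> F] --> s k) ->
  forall j, (root_prod m (S M))`_j @[M --> F] --> (root_prod m s)`_j.
Proof.
elim: m => [|m IH] Ss j.
  by under eq_cvg do rewrite /root_prod big_ord0; rewrite /root_prod big_ord0; exact: cvg_cst.
under eq_cvg do rewrite coef_root_prodS; rewrite coef_root_prodS.
have {}IH := IH (fun k km => Ss k (ltnW km)).
apply: cvgB; last by apply: cvgM; [exact: Ss|exact: IH].
by case: j => [|j]; [exact: cvg_cst | exact: IH].
Qed.

(** Along an ultrafilter every bounded sequence converges, so all root sequences get limits along
    one filter and no subsequence has to be extracted. *)
Lemma ultra_segment_cvg (F : set_system nat) {FU : UltraFilter F} (f : nat -> R) a b :
  (\forall M \near F, a <= f M <= b) -> exists l : R, f M @[M --> F] --> l.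
Proof.
move=> fab; have Fab : fmap f F `[a, b]%classic.
  by rewrite /fmap /=; apply: filterS fab => M; rewrite /= in_itv.
have [l [_ ll]] := @segment_compact R a b (fmap f F) _ Fab.
exists l => A Al.
have [//|nA] := @in_ultra_setVsetC _ F (f @^-1` A) FU.
by have [x [/= nAx Ax]] := ll (~` A) A nA Al.
Qed.

Lemma splits_sum_roots m p s : splits m.+1 p s ->
  \sum_(k < m.+1) s k = - (p`_m / p`_m.+1).
Proof.
move=> [p0 pE]; have : (root_prod m.+1 s)`_m = - \sum_(k < m.+1) s k.
  have := @coefPn_prod_XsubC _ (mkseq s m.+1); rewrite size_mkseq /= => /(_ isT).
  rewrite root_prodE => ->; congr (- _); rewrite /mkseq big_map.
  by rewrite -(big_mkord xpredT s) /index_iota subn0.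
by move=> /(congr1 -%R); rewrite opprK => <-; rewrite [in p`_m]pE coefZ mulrAC divff // mul1r.
Qed.

(* The nonnegative roots stay bounded because their sum is read off two coefficients. *)
Lemma splits_closed (F : set_system nat) {FU : UltraFilter F} m
    (P : nat -> {poly R}) p (S : nat -> nat -> R) :
  (forall M, splits m (P M) (S M)) -> (forall M k, (k < m)%N -> 0 <= S M k) ->
  (forall j, (P M)`_j @[M --> F] --> p`_j) -> p`_m != 0 ->
  exists2 s, splits m p s & forall k, (k < m)%N -> S M k @[M --> F] --> s k.
Proof.
move=> PS S0 Pp pm.
have /choice[s Ss] : forall k, exists l : R, (k < m)%N -> S M k @[M --> F] --> l.
  move=> k; have [km|] := ltnP k m; last by exists 0.
  suff [l Sl] : exists l : R, S M k @[M --> F] --> l by exists l.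
  case: m PS S0 Pp pm km => // m PS S0 Pp pm km.
  have cB : - ((P M)`_m / (P M)`_m.+1) @[M --> F] --> - (p`_m / p`_m.+1).
    by apply: cvgN; apply: cvgM; [exact: Pp | exact: cvgV (Pp _)].
  apply: (@ultra_segment_cvg F _ _ 0 (- (p`_m / p`_m.+1) + 1)).
  have := cvgr_le _ cB (- (p`_m / p`_m.+1) + 1); rewrite ltrDl ltr01 => /(_ _ isT).
  apply: filterS => M le_B; rewrite S0 //=; apply: le_trans le_B.
  rewrite -(splits_sum_roots (PS M)) (bigD1 (Ordinal km)) //= lerDl.
  by apply: sumr_ge0 => i _; exact: S0.
exists s => //; split=> //; apply/polyP => j.
apply: (@norm_cvg_unique _ R (fmap (fun M => (P M)`_j) F)); first exact: Pp.
rewrite coefZ /=.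
have -> : (fun M => (P M)`_j) = (fun M => (P M)`_m * (root_prod m (S M))`_j).
  by apply/funext => M; rewrite [in LHS](proj2 (PS M)) coefZ.
by apply: cvgM; [exact: Pp | exact: cvg_coef_root_prod].
Qed.

(** Along an ultrafilter finer than [\oo] the coefficients keep their limits and the roots acquire
    limits; weak inequalities survive. *)
Lemma interlaced_closed m (P Q : nat -> {poly R}) p q :
  (forall M, interlaced m (P M) (Q M)) ->
  (forall j, (P M)`_j @[M --> \oo] --> p`_j) -> p`_m != 0 ->
  (forall j, (Q M)`_j @[M --> \oo] --> q`_j) -> q`_m != 0 ->
  interlaced m p q.
Proof.
move=> /choice[S /choice[U SU]] Pp pm Qq qm.
have [F [FU oF]] := ultraFilterLemma (eventually_filter : ProperFilter \oo).
have toF (f : nat -> R) l : f M @[M --> \oo] --> l -> f M @[M --> F] --> l.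
  by apply: cvg_trans => A; exact: oF.
have [|M k km|j||s Hs Ss] := @splits_closed F FU m P p S.
- by move=> M; have [] := SU M.
- by have [_ _ /(_ _ km)/andP[]] := SU M.
- exact/toF/Pp.
- by [].
have [|M k km|j||u Hu Uu] := @splits_closed F FU m Q q U.
- by move=> M; have [] := SU M.
- by have [_ _ /(_ _ km)/andP[+ +] _] := SU M; exact: le_trans.
- exact/toF/Qq.
- by [].
exists s, u; split=> // k km; last first.
  apply: (ler_cvg_to (Uu _ (ltnW km)) (Ss _ km)).
  by apply: nearW => M; have [_ _ _] := SU M; exact.
apply/andP; split.
  apply: (ler_cvg_to (cvg_cst 0) (Ss _ km)).
  by apply: nearW => M; have [_ _ /(_ _ km)/andP[]] := SU M.
apply: (ler_cvg_to (Ss _ km) (Uu _ km)).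
by apply: nearW => M; have [_ _ /(_ _ km)/andP[]] := SU M.
Qed.

Lemma dominated_closed m (P Q : nat -> {poly R}) p q :
  (forall M, dominated m (P M) (Q M)) ->
  (forall j, (P M)`_j @[M --> \oo] --> p`_j) -> p`_m != 0 ->
  (forall j, (Q M)`_j @[M --> \oo] --> q`_j) -> q`_m != 0 ->
  dominated m p q.
Proof.
move=> /choice[S /choice[U SU]] Pp pm Qq qm.
have [F [FU oF]] := ultraFilterLemma (eventually_filter : ProperFilter \oo).
have toF (f : nat -> R) l : f M @[M --> \oo] --> l -> f M @[M --> F] --> l.
  by apply: cvg_trans => A; exact: oF.
have [|M k km|j||s Hs Ss] := @splits_closed F FU m P p S.
- by move=> M; have [] := SU M.
- by have [_ _ /(_ _ km)/andP[]] := SU M.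
- exact/toF/Pp.
- by [].
have [|M k km|j||u Hu Uu] := @splits_closed F FU m Q q U.
- by move=> M; have [] := SU M.
- by have [_ _ /(_ _ km)/andP[+ +] _ _] := SU M; exact: le_trans.
- exact/toF/Qq.
- by [].
exists s, u; split=> // k km.
- apply/andP; split.
    apply: (ler_cvg_to (cvg_cst 0) (Ss _ km)).
    by apply: nearW => M; have [_ _ /(_ _ km)/andP[]] := SU M.
  apply: (ler_cvg_to (Ss _ km) (Uu _ km)).
  by apply: nearW => M; have [_ _ /(_ _ km)/andP[]] := SU M.
- apply: (ler_cvg_to (Ss _ (ltnW km)) (Ss _ km)).
  by apply: nearW => M; have [_ _ _ + _] := SU M; exact.
- apply: (ler_cvg_to (Uu _ (ltnW km)) (Uu _ km)).
  by apply: nearW => M; have [_ _ _ _] := SU M; exact.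
Qed.

Lemma cvg_perturb s (a : nat -> R) k : s k + a k * harmonic M @[M --> \oo] --> s k.
Proof.
rewrite -[X in _ --> X]addr0; apply: cvgD; first exact: cvg_cst.
by rewrite -(mulr0 (a k)); apply: cvgM; [exact: cvg_cst | exact: cvg_harmonic].
Qed.

Lemma cvg_coef_euler m (S : nat -> nat -> R) s b c :
  (forall k, (k < m)%N -> S M k @[M --> \oo] --> s k) ->
  forall j, (euler b c (root_prod m (S M)))`_j @[M --> \oo] -->
    (euler b c (root_prod m s))`_j.
Proof.
move=> Ss j; under eq_cvg do rewrite coef_euler; rewrite coef_euler.
by apply: cvgM; [exact: cvg_cst | exact: cvg_coef_root_prod].
Qed.

Lemma euler_scale a b c p : euler b c (a *: p) = a *: euler b c p.
Proof. by rewrite /euler derivZ -scalerAr scalerDr !scalerA !(mulrC a). Qed.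

(* Perturbing the roots makes a weakly interlacing pair strictly interlacing. *)
Lemma interlaced_perturb m p q b c : interlaced m p q ->
  (forall s u, (forall k, (k < m)%N -> 0 < s k < u k) ->
     (forall k, (k.+1 < m)%N -> u k < s k.+1) ->
     strictly_interlaced m (euler b c (root_prod m s)) (euler b c (root_prod m u))) ->
  b + c * m%:R != 0 -> interlaced m (euler b c p) (euler b c q).
Proof.
move=> [s [u [[p0 ->] [q0 ->] su us]]] H bc.
rewrite !euler_scale; apply: interlaced_scale => //.
(* The shifts 1, 2, 3, 4, ... times [harmonic M] run along the chain
   [s 0 <= u 0 <= s 1 <= u 1 <= ...], making every inequality strict and every root positive. *)
pose S M k : R := s k + (2 * k + 1)%:R * harmonic M.
pose U M k : R := u k + (2 * k + 2)%:R * harmonic M.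
apply: (@interlaced_closed m (fun M => euler b c (root_prod m (S M)))
    (fun M => euler b c (root_prod m (U M)))).
- move=> M; apply/strictly_interlacedW/H => k km.
    have /andP[s0 sk] := su _ km; have h0 := @harmonic_gt0 R M.
    apply/andP; split; first by rewrite ltr_wpDl // mulr_gt0 // ltr0n addn1.
    by rewrite ler_ltD // ltr_pM2r // ltr_nat ltn_add2l.
  rewrite ler_ltD ?us // ltr_pM2r ?harmonic_gt0 // ltr_nat.
  by rewrite mulnS (addnC 2%N) -addnA ltn_add2l.
- by apply: cvg_coef_euler => k _; exact: (@cvg_perturb s (fun k => (2 * k + 1)%:R)).
- by rewrite coef_euler coef_root_prod_top mulr1.
- by apply: cvg_coef_euler => k _; exact: (@cvg_perturb u (fun k => (2 * k + 2)%:R)).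
- by rewrite coef_euler coef_root_prod_top mulr1.
Qed.

Lemma euler_up_weak_mono m p b b' : 0 < b -> b < b' -> interlaced m p p ->
  interlaced m (euler b 1 p) (euler b' 1 p).
Proof.
move=> b0 bb' /interlaced_dominated[s [u [[p0 ->] _ s0 sinc _]]].
rewrite !euler_scale; apply: interlaced_scale => //.
(* Increasing shifts separate multiple roots and move a root at 0 to the right, as [euler_up_mono]
   asks for simple positive roots. *)
pose S M k : R := s k + (k.+1)%:R * harmonic M.
apply: (@interlaced_closed m (fun M => euler b 1 (root_prod m (S M)))
    (fun M => euler b' 1 (root_prod m (S M)))).
- move=> M; apply/strictly_interlacedW/euler_up_mono => // k km.
    have /andP[sk _] := s0 _ km.
    by rewrite ltr_wpDl // mulr_gt0 ?harmonic_gt0.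
  by rewrite ler_ltD ?sinc // ltr_pM2r ?harmonic_gt0 // ltr_nat.
- by apply: cvg_coef_euler => k _; exact: (@cvg_perturb s (fun k => k.+1%:R)).
- by rewrite coef_euler coef_root_prod_top mulr1 mul1r gt_eqF // ltr_pwDl.
- by apply: cvg_coef_euler => k _; exact: (@cvg_perturb s (fun k => k.+1%:R)).
- by rewrite coef_euler coef_root_prod_top mulr1 mul1r gt_eqF // ltr_pwDl // (lt_trans b0).
Qed.

Lemma euler_up_preserves m p q b : 0 < b -> interlaced m p q ->
  interlaced m (euler b 1 p) (euler b 1 q).
Proof.
move=> b0 /interlaced_perturb; apply.
- by move=> s u; exact: euler_up_interlaced.
- by rewrite gt_eqF // mul1r ltr_pwDl.
Qed.

Lemma euler_dn_preserves m p q b : m%:R < b -> interlaced m p q ->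
  interlaced m (euler b (-1) p) (euler b (-1) q).
Proof.
move=> b0 /interlaced_perturb; apply.
- by move=> s u; exact: euler_dn_interlaced.
- by rewrite gt_eqF // mulN1r subr_gt0.
Qed.

End Limits.

(** * Coefficient multipliers *)

Definition multiplier (R : realType) (w : nat -> R) (p : {poly R}) : {poly R} :=
  \poly_(k < size p) (w k * p`_k).

(** Stated for pairs; preservation of nonnegative real roots is the diagonal case [p = q]. *)
Definition preserves (R : realType) (m : nat) (w : nat -> R) : Prop :=
  forall p q : {poly R}, interlaced m p q ->
    interlaced m (multiplier w p) (multiplier w q).

Definition rising (R : realType) (c : R) (k : nat) : R := \prod_(i < k) (c + i%:R).
Definition falling (R : realType) (c : R) (k : nat) : R := \prod_(i < k) (c - i%:R).

Section Multipliers.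
Variable R : realType.
Implicit Types (m : nat) (s u w v : nat -> R) (p q : {poly R}).

Lemma coef_multiplier w p k : (multiplier w p)`_k = w k * p`_k.
Proof. by rewrite coef_poly; case: ltnP => // pk; rewrite nth_default // mulr0. Qed.

Lemma multiplier_comp w v p :
  multiplier w (multiplier v p) = multiplier (fun k => w k * v k) p.
Proof. by apply/polyP => k; rewrite !coef_multiplier mulrA. Qed.

Lemma eq_multiplier m w v p : (size p <= m.+1)%N ->
  (forall k, (k <= m)%N -> w k = v k) -> multiplier w p = multiplier v p.
Proof.
move=> sp wv; apply/polyP => k; rewrite !coef_multiplier.
have [/wv->//|mk] := leqP k m.
by rewrite nth_default ?mulr0 //; apply: leq_trans mk.
Qed.

Lemma multiplier_euler b d p : multiplier (fun k => b + d * k%:R) p = euler b d p.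
Proof. by apply/polyP => k; rewrite coef_multiplier coef_euler. Qed.

Lemma preserves_eq m w v : (forall k, (k <= m)%N -> w k = v k) ->
  preserves m w -> preserves m v.
Proof.
move=> wv Pw p q pq; have [s [u [Hs Hu _ _]]] := pq.
have sz (f : {poly R}) (t : nat -> R) : splits m f t -> (size f <= m.+1)%N by move=> /splits_size ->.
by rewrite -(eq_multiplier (sz _ _ Hs) wv) -(eq_multiplier (sz _ _ Hu) wv); exact: Pw.
Qed.

Lemma preserves_mul m w v : preserves m w -> preserves m v ->
  preserves m (fun k => w k * v k).
Proof. by move=> Pw Pv p q pq; rewrite -!multiplier_comp; exact/Pw/Pv. Qed.

Lemma multiplier_const c p : multiplier (fun=> c) p = c *: p.
Proof. by apply/polyP => k; rewrite coef_multiplier coefZ. Qed.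

Lemma preserves_const m (c : R) : c != 0 -> preserves m (fun=> c).
Proof. by move=> c0 p q pq; rewrite !multiplier_const; exact: interlaced_scale. Qed.

Lemma preserves_up m (b : R) : 0 < b -> preserves m (fun k => b + k%:R).
Proof.
move=> b0; apply: (@preserves_eq _ (fun k => b + 1 * k%:R)).
  by move=> k _; rewrite mul1r.
by move=> p q pq; rewrite !multiplier_euler; exact: euler_up_preserves.
Qed.

Lemma preserves_dn m (b : R) : m%:R < b -> preserves m (fun k => b - k%:R).
Proof.
move=> b0; apply: (@preserves_eq _ (fun k => b + -1 * k%:R)).
  by move=> k _; rewrite mulN1r.
by move=> p q pq; rewrite !multiplier_euler; exact: euler_dn_preserves.
Qed.

(** The multiplier [c ^+ k] is the substitution of [c x] for [x]. Negative [c] is allowed because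
    [c = -1] gives the final reflection. *)
Lemma splits_dilate m p s c : c != 0 -> splits m p s ->
  splits m (multiplier (fun k => c ^+ k) p) (fun k => s k / c).
Proof.
move=> c0 [p0 pE].
have key j : c ^+ j * (root_prod m s)`_j = c ^+ m * (root_prod m (fun k => s k / c))`_j.
  elim: m {p p0 pE} j => [|m IH] j.
    by rewrite /root_prod !big_ord0 coef1; case: j => [|j]; rewrite ?mulr0 ?mulr1.
  rewrite !coef_root_prodS !mulrBr !(mulrCA (c ^+ _) (s m)) IH.
  have -> : c ^+ m.+1 * (s m / c * (root_prod m (fun k => s k / c))`_j)
      = s m * (c ^+ m * (root_prod m (fun k => s k / c))`_j).
    by rewrite exprS; field.
  congr (_ - _); case: j => [|j]; first by rewrite !mulr0.
  by rewrite !exprS -!mulrA IH.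
split; first by rewrite coef_multiplier mulf_neq0 // expf_neq0.
apply/polyP => j; rewrite coefZ !coef_multiplier [in LHS]pE coefZ.
by rewrite mulrCA key; ring.
Qed.

Lemma preserves_dilate m (c : R) : 0 < c -> preserves m (fun k => c ^+ k).
Proof.
move=> c0 p q [s [u [Hs Hu su us]]].
exists (fun k => s k / c), (fun k => u k / c); split.
- by apply: splits_dilate; rewrite // gt_eqF.
- by apply: splits_dilate; rewrite // gt_eqF.
- by move=> k /su/andP[s0 sk]; rewrite divr_ge0 //= ?(ltW c0) // ler_pM2r ?invr_gt0.
- by move=> k /us; rewrite ler_pM2r ?invr_gt0.
Qed.

Lemma dominated_dilate m p q c : 0 < c -> dominated m p q ->
  dominated m (multiplier (fun k => c ^+ k) p) (multiplier (fun k => c ^+ k) q).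
Proof.
move=> c0 [s [u [Hs Hu su sinc uinc]]].
exists (fun k => s k / c), (fun k => u k / c); split.
- by apply: splits_dilate; rewrite // gt_eqF.
- by apply: splits_dilate; rewrite // gt_eqF.
- by move=> k /su/andP[s0 sk]; rewrite divr_ge0 //= ?(ltW c0) // ler_pM2r ?invr_gt0.
- by move=> k /sinc; rewrite ler_pM2r ?invr_gt0.
- by move=> k /uinc; rewrite ler_pM2r ?invr_gt0.
Qed.

Lemma preserves_prod m (I : Type) (r : seq I) (P : pred I) (w : I -> nat -> R) :
  (forall i, P i -> preserves m (w i)) -> preserves m (fun k => \prod_(i <- r | P i) w i k).
Proof.
move=> Pw; elim: r => [|i r IH].
  apply: (@preserves_eq m (fun=> 1)); first by move=> k _; rewrite big_nil.
  exact/preserves_const/oner_neq0.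
have [Pi|nPi] := boolP (P i).
  apply: preserves_eq (preserves_mul (Pw _ Pi) IH) => k _.
  by rewrite big_cons Pi.
by apply: preserves_eq IH => k _; rewrite big_cons (negbTE nPi).
Qed.

Lemma cvg_multiplier m p (W : nat -> nat -> R) w : (size p <= m.+1)%N ->
  (forall k, (k <= m)%N -> W M k @[M --> \oo] --> w k) ->
  forall j, (multiplier (W M) p)`_j @[M --> \oo] --> (multiplier w p)`_j.
Proof.
move=> sp Ww j; under eq_cvg do rewrite coef_multiplier; rewrite coef_multiplier.
have [jm|mj] := leqP j m; first by apply: cvgM; [exact: Ww | exact: cvg_cst].
have -> : p`_j = 0 by rewrite nth_default //; apply: leq_trans mj.
rewrite mulr0 (_ : (fun M => W M j * 0) = fun=> 0); first exact: cvg_cst.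
by apply/funext => M; rewrite mulr0.
Qed.

(** The condition [w m != 0] keeps the limit in degree [m], so that no root escapes to infinity. *)
Lemma preserves_lim m (W : nat -> nat -> R) w : (forall M, preserves m (W M)) ->
  (forall k, (k <= m)%N -> W M k @[M --> \oo] --> w k) -> w m != 0 -> preserves m w.
Proof.
move=> PW Ww wm p q pq; have [s [u [Hs Hu _ _]]] := pq.
have cv (f : {poly R}) (t : nat -> R) : splits m f t -> forall j,
    (multiplier (W M) f)`_j @[M --> \oo] --> (multiplier w f)`_j.
  by move=> Hf; apply: (cvg_multiplier (m := m)) => //; rewrite (splits_size Hf).
apply: (@interlaced_closed _ m (fun M => multiplier (W M) p) (fun M => multiplier (W M) q)).
- by move=> M; exact: PW.
- exact: cv Hs.
- by rewrite coef_multiplier mulf_neq0 //; case: Hs.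
- exact: cv Hu.
- by rewrite coef_multiplier mulf_neq0 //; case: Hu.
Qed.

(** * Pochhammer symbols as limits of products of linear factors *)

Lemma risingS (c : R) k : rising c k.+1 = rising c k * (c + k%:R).
Proof. by rewrite /rising big_ord_recr. Qed.

Lemma risingD (c : R) j k : rising c (j + k) = rising c j * rising (c + j%:R) k.
Proof.
elim: k => [|k IH]; first by rewrite addn0 /rising big_ord0 mulr1.
by rewrite addnS !risingS IH natrD addrA mulrA.
Qed.

Lemma rising1 (c : R) : rising c 1 = c.
Proof. by rewrite /rising big_ord1 addr0. Qed.

Lemma rising_gt0 (c : R) k : 0 < c -> 0 < rising c k.
Proof. by move=> c0; apply: prodr_gt0 => i _; rewrite ltr_wpDr. Qed.

Lemma falling_rising (e : R) k : falling e k = rising (e + 1 - k%:R) k.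
Proof.
rewrite /falling (reindex_inj rev_ord_inj) /=; apply: eq_bigr => i _.
by rewrite natrB //; rewrite -natr1; ring.
Qed.

Lemma cvg_ratio (c : R) : (c + M%:R) / M.+1%:R @[M --> \oo] --> (1 : R).
Proof.
have -> : (fun M : nat => (c + M%:R) / M.+1%:R) = (fun M => 1 + (c - 1) * harmonic M).
  by apply/funext => M /=; rewrite -natr1; field; rewrite natr1 pnatr_eq0.
rewrite -[X in _ --> X]addr0; apply: cvgD; first exact: cvg_cst.
by rewrite -(mulr0 (c - 1)); apply: cvgM; [exact: cvg_cst | exact: cvg_harmonic].
Qed.

Lemma cvg_prod_one k (F : nat -> nat -> R) :
  (forall i, (i < k)%N -> F M i @[M --> \oo] --> (1 : R)) ->
  \prod_(i < k) F M i @[M --> \oo] --> (1 : R).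
Proof.
elim: k => [|k IH] F1; first by under eq_cvg do rewrite big_ord0; exact: cvg_cst.
have -> : (fun M => \prod_(i < k.+1) F M i) = (fun M => \prod_(i < k) F M i * F M k).
  by apply/funext => M; rewrite big_ord_recr.
rewrite -[X in _ --> X]mulr1.
by apply: cvgM; [apply: IH => i ik; apply/F1/ltnW | exact: F1].
Qed.

(* [(c + k)_M / ((c)_M (M + 1)^k)]: a finite product of factors [b + k] which tends
   to [1 / (c)_k]. *)
Definition rising_approx (c : R) (M k : nat) : R :=
  rising (c + k%:R) M * ((rising c M)^-1 * (M.+1%:R^-1) ^+ k).

(** Splitting [(c)_(M + k)] in two ways gives [(c + k)_M / (c)_M = (c + M)_k / (c)_k]; the [k]
    factors [(c + i + M) / (M + 1)] tend to 1. *)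
Lemma cvg_rising_approx (c : R) k : 0 < c ->
  rising_approx c M k @[M --> \oo] --> (rising c k)^-1.
Proof.
move=> c0; have -> : (rising_approx c)^~ k = (fun M : nat => (rising c k)^-1 *
    \prod_(i < k) ((c + i%:R + M%:R) / M.+1%:R)).
  apply/funext => M; rewrite /rising_approx big_split /= prodr_const card_ord.
  have -> : \prod_(i < k) (c + i%:R + M%:R) = rising (c + M%:R) k.
    by apply: eq_bigr => i _; ring.
  have rM := rising_gt0 M c0; have rk := rising_gt0 k c0.
  have := risingD c M k; rewrite addnC risingD => E.
  rewrite mulrA mulrA; congr (_ * _); apply: (mulfI (lt0r_neq0 rk)).
  by rewrite mulrA E mulrAC divff ?lt0r_neq0 // mul1r mulrA divff ?lt0r_neq0 // mul1r.
rewrite -[X in _ --> X]mulr1; apply: cvgM; first exact: cvg_cst.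
apply: (@cvg_prod_one k (fun M i => (c + i%:R + M%:R) / M.+1%:R)) => i _.
exact: cvg_ratio.
Qed.

(** Each approximant is a product of factors [b + k] with [b = c + j > 0], a constant and a
    dilation. *)
Lemma preserves_rising m (c : R) : 0 < c -> preserves m (fun k => (rising c k)^-1).
Proof.
move=> c0; apply: (@preserves_lim m (rising_approx c)).
- move=> M; rewrite /rising_approx; refine (preserves_mul _ _).
    apply: (@preserves_eq m (fun k => \prod_(j < M) (c + j%:R + k%:R))).
      by move=> k _; apply: eq_bigr => j _; ring.
    by refine (preserves_prod _ _) => j _; apply: preserves_up; rewrite ltr_wpDr.
  refine (preserves_mul _ _); first by apply: preserves_const; rewrite invr_neq0 // gt_eqF ?rising_gt0.
  by apply: preserves_dilate; rewrite invr_gt0.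
- by move=> k _; exact: cvg_rising_approx.
- by rewrite invr_neq0 // gt_eqF ?rising_gt0.
Qed.

(** The approximant [(e + 1 - k)_M (M + 1)^k / (e + 1)_M] has factors [b - k] with
    [b = e + 1 + j > m]. It is [falling e k] times the product over [i < k] of
    [(M + 1) / (e - i + M)]. *)
Lemma preserves_falling m (e : R) : m%:R - 1 < e -> preserves m (falling e).
Proof.
move=> me.
have e10 : 0 < e + 1 by rewrite -ltrBlDr; apply: le_lt_trans me; rewrite lerD2r.
apply: (@preserves_lim m (fun M k => rising (e + 1 - k%:R) M *
    ((rising (e + 1) M)^-1 * (M.+1%:R) ^+ k))).
- move=> M; refine (preserves_mul _ _).
    apply: (@preserves_eq m (fun k => \prod_(j < M) (e + 1 + j%:R - k%:R))).
      by move=> k _; apply: eq_bigr => j _; ring.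
    refine (preserves_prod _ _) => j _; apply: preserves_dn.
    by rewrite ltr_wpDr // -ltrBlDr.
  refine (preserves_mul _ _); first by apply: preserves_const; rewrite invr_neq0 // gt_eqF ?rising_gt0.
  exact: preserves_dilate.
- move=> k km.
  have pos (M i : nat) : (i < k)%N -> 0 < e - i%:R + M%:R.
    move=> ik; rewrite ltr_wpDr // subr_gt0; apply: le_lt_trans me.
    by rewrite lerBrDr natr1 ler_nat; apply: leq_trans km.
  have -> : (fun M : nat => rising (e + 1 - k%:R) M * ((rising (e + 1) M)^-1 * M.+1%:R ^+ k))
    = (fun M : nat => falling e k * \prod_(i < k) ((e - i%:R + M%:R) / M.+1%:R)^-1).
    apply/funext => M.
    have E : rising (e + 1 - k%:R) M * \prod_(i < k) (e - i%:R + M%:R)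
        = falling e k * rising (e + 1) M.
      have -> : \prod_(i < k) (e - i%:R + M%:R) = falling (e + M%:R) k.
        by apply: eq_bigr => i _; ring.
      rewrite !falling_rising (_ : e + M%:R + 1 - k%:R = e + 1 - k%:R + M%:R); last by ring.
      by rewrite -risingD addnC risingD subrK.
    have p0 : \prod_(i < k) (e - i%:R + M%:R) != 0.
      by rewrite gt_eqF // prodr_gt0 // => i _; exact: pos.
    rewrite prodfV big_split /= prodr_const card_ord invfM -exprVn invrK.
    have r0 : rising (e + 1) M != 0 by rewrite gt_eqF ?rising_gt0.
    rewrite mulrA [in RHS]mulrA; congr (_ * _).
    by apply: (mulIf p0); rewrite mulrAC E mulfK // divfK.
  rewrite -[X in _ --> X]mulr1; apply: cvgM; first exact: cvg_cst.
  apply: (@cvg_prod_one k (fun M i => ((e - i%:R + M%:R) / M.+1%:R)^-1)) => i ik.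
  rewrite -[X in _ --> X]invr1.
  by apply: cvgV (oner_neq0 _) _; exact: cvg_ratio.
- rewrite /falling gt_eqF // prodr_gt0 // => i _; rewrite subr_gt0.
  by apply: le_lt_trans me; rewrite lerBrDr natr1 ler_nat.
Qed.

End Multipliers.

(** * Laguerre polynomials *)

(* Up to a constant factor, the Laguerre polynomial of degree [m] and parameter [a - 1]. *)
Definition lag (R : realType) (m : nat) (a : R) : {poly R} :=
  multiplier (fun k => (rising a k)^-1) (root_prod m (fun=> 1)).

Section Laguerre.
Variable R : realType.
Implicit Types (m : nat) (a x : R) (s u : nat -> R) (p q : {poly R}).

(** This is [(X - 1) p' = m p] for [p = (X - 1)^m], read on coefficients. *)
Lemma coef_root_prod1S m k :
  k.+1%:R * (root_prod m (fun=> 1 : R))`_k.+1 =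
  (k%:R - m%:R) * (root_prod m (fun=> 1 : R))`_k.
Proof.
suff E : euler (- m%:R) 1 (root_prod m (fun=> 1 : R)) = (root_prod m (fun=> 1 : R))^`().
  have := congr1 (coefp k) E; rewrite /= coef_euler coef_deriv => E'.
  by rewrite mulr_natl -E'; ring.
rewrite /root_prod prodr_const card_ord; case: m => [|m].
  by rewrite expr0 -polyC1 /euler derivC mulr0 scaler0 oppr0 scale0r addr0.
rewrite /euler scale1r scaleNr scaler_nat deriv_exp derivXsubC mul1r /=.
by rewrite exprS -mulrnAr polyC1; set q := _ *+ _; ring.
Qed.

Lemma rising_shift a k : a * rising (a + 1) k = rising a k * (a + k%:R).
Proof. by rewrite -risingS -add1n risingD rising1. Qed.

Lemma rising_ge1 a k : 1 <= a -> 1 <= rising a k.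
Proof.
move=> a1; elim: k => [|k IH]; first by rewrite /rising big_ord0.
by rewrite risingS mulr_ege1 // (le_trans a1) // lerDl.
Qed.

Lemma coef_lag m a k : (lag m a)`_k = (rising a k)^-1 * (root_prod m (fun=> 1))`_k.
Proof. exact: coef_multiplier. Qed.

Lemma coef_lag_top m a : (lag m a)`_m = (rising a m)^-1.
Proof. by rewrite coef_lag coef_root_prod_top mulr1. Qed.

(** A contiguous relation lowering the parameter; on coefficients it is
    [(a + k) / (a + 1)_k = a / (a)_k]. *)
Lemma euler_lag m a : 0 < a -> euler a 1 (lag m (a + 1)) = a *: lag m a.
Proof.
move=> a0; apply/polyP => k; rewrite coef_euler coefZ !coef_lag.
have r0 := rising_gt0 k a0; have r1 := rising_gt0 k (addr_gt0 a0 (ltr01 : 0 < 1 :> R)).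
have E := rising_shift a k; set b := (root_prod _ _)`_k.
have -> : (rising (a + 1) k)^-1 = a / (rising a k * (a + k%:R)).
  by rewrite -E; field; rewrite !gt_eqF.
by field; rewrite !gt_eqF // ltr_wpDr.
Qed.

(** The contiguous relation raising the parameter: [coef_root_prod1S] brings the coefficient of
    index [k + 1] in the derivative back to index [k]. *)
Lemma deriv_lag m a : 0 < a ->
  (a + m%:R) *: lag m (a + 1) = a *: (lag m a - (lag m a)^`()).
Proof.
move=> a0; apply/polyP => k; rewrite !coefZ coefB coef_deriv !coef_lag.
rewrite -mulrnAr -[_ *+ k.+1]mulr_natl coef_root_prod1S risingS.
have r0 := rising_gt0 k a0; have r1 := rising_gt0 k (addr_gt0 a0 (ltr01 : 0 < 1 :> R)).
have E := rising_shift a k; set b := (root_prod _ _)`_k.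
have -> : (rising (a + 1) k)^-1 = a / (rising a k * (a + k%:R)).
  by rewrite -E; field; rewrite !gt_eqF.
by field; rewrite !gt_eqF // ltr_wpDr.
Qed.

(** The multiplier is applied to [(X - 1)^m], which trivially interlaces itself. *)
Lemma lag_interlaced_refl m a : 0 < a -> interlaced m (lag m a) (lag m a).
Proof.
move=> a0; apply: preserves_rising => //.
apply: (@interlaced_refl _ _ _ (fun=> 1)) => //.
by have := splits_root_prod m (fun=> 1 : R) (oner_neq0 R); rewrite scale1r.
Qed.

Lemma horner_root_prod1_0 m : (root_prod m (fun=> 1 : R))`_0 != 0.
Proof.
rewrite -horner_coef0 horner_root_prod; apply/prodf_neq0 => i _.
by rewrite sub0r oppr_eq0 oner_eq0.
Qed.

(* A double root would be shared by all the polynomials [lag m (a + j)], which tend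
   to a nonzero constant. *)
Lemma lag_no_double_root m a x : 0 < a -> 0 < x ->
  (lag m a).[x] = 0 -> (lag m a)^`().[x] != 0.
Proof.
move=> a0 x0 L0; apply/negP => /eqP D0.
(* [deriv_lag] makes the value at the next parameter vanish at [x], and then [euler_lag] does the
   same for the derivative, as [x > 0]. *)
have step j : (lag m (a + j%:R)).[x] = 0 /\ (lag m (a + j%:R))^`().[x] = 0.
  elim: j => [|j [IH1 IH2]]; first by rewrite addr0.
  have aj : 0 < a + j%:R by rewrite ltr_wpDr.
  rewrite -natr1 addrA; have := congr1 (horner^~ x) (deriv_lag m aj).
  rewrite !hornerZ hornerD hornerN IH1 IH2 subrr mulr0 => /eqP.
  rewrite mulf_eq0 gt_eqF ?ltr_wpDr //= => /eqP Z1; split=> //.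
  have := congr1 (horner^~ x) (euler_lag m aj).
  rewrite horner_euler hornerZ Z1 IH1 !mulr0 add0r mul1r => /eqP.
  by rewrite mulf_eq0 gt_eqF //= => /eqP.
set b := root_prod m (fun=> 1 : R) in step *.
have b0 : 0 < `|b`_0| by rewrite normr_gt0 horner_root_prod1_0.
(* Vanishing at [x] bounds the constant coefficient by the other terms, each divided by a Pochhammer
   symbol of [a + j + 1] that is at least [a + j + 1]. A fixed [C] thus bounds all multiples of a
   positive number. *)
pose C := \sum_(k < m) `|b`_k.+1 * x ^+ k.+1|.
have bound j : j.+1%:R * `|b`_0| <= C.
  have cj : 1 <= a + j.+1%:R by rewrite -natr1 addrA addrC lerDl addr_ge0 // ltW.
  have c0 : 0 < a + j.+1%:R by apply: lt_le_trans cj.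
  have [/eqP + _] := step j.+1.
  rewrite (@horner_coef_wide _ m.+1); last first.
    by rewrite (leq_trans (size_poly _ _)) // size_root_prod.
  rewrite big_ord_recl coef_lag /rising big_ord0 invr1 mul1r expr0 mulr1 addr_eq0.
  move=> /eqP ->; rewrite normrN.
  apply: (@le_trans _ _ (j.+1%:R * \sum_(k < m) (`|b`_k.+1 * x ^+ k.+1| / (a + j.+1%:R)))).
    apply: ler_wpM2l => //; apply: le_trans (ler_norm_sum _ _ _) _.
    apply: ler_sum => k _; rewrite coef_lag lift0 -/b -mulrA mulrC normrM.
    apply: ler_wpM2l => //.
    have r0 := rising_gt0 k.+1 c0.
    rewrite ger0_norm ?invr_ge0 ?(ltW r0) // lef_pV2 ?posrE // -[k.+1]add1n risingD rising1.
    by rewrite ler_peMr ?(ltW c0) // rising_ge1 // (le_trans cj) // lerDl.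
  rewrite -mulr_suml mulrCA ler_piMr ?sumr_ge0 // ler_pdivrMr // mul1r lerDr ltW //.
have := bound (Num.bound (C / `|b`_0|)); rewrite leNgt => /negP; apply.
rewrite -ltr_pdivrMr //; apply: lt_trans (archi_boundP _) _.
  by rewrite divr_ge0 // sumr_ge0.
by rewrite ltr_nat.
Qed.

(** The constant coefficient excludes the root 0, and two equal consecutive roots would be a zero of
    the derivative. *)
Lemma lag_simple m a : 0 < a -> exists s, [/\ splits m (lag m a) s,
  forall k, (k < m)%N -> 0 < s k & forall k, (k.+1 < m)%N -> s k < s k.+1].
Proof.
move=> a0.
have [s [u [Hs _ su sinc _]]] := interlaced_dominated (lag_interlaced_refl m a0).
have spos k : (k < m)%N -> 0 < s k.
  move=> km; have /andP[s0 _] := su _ km; rewrite lt_neqAle s0 andbT.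
  apply/eqP => sk; have := splits_root Hs km; rewrite -sk horner_coef0 coef_lag.
  by apply/eqP; rewrite mulf_neq0 ?horner_root_prod1_0 // invr_neq0 // gt_eqF ?rising_gt0.
exists s; split=> // k km; rewrite lt_neqAle sinc // andbT; apply/eqP => sk.
have := lag_no_double_root a0 (spos _ (ltnW km)) (splits_root Hs (ltnW km)).
case: Hs => _ ->; rewrite derivZ hornerZ deriv_root_prodE ?(ltnW km) //.
rewrite (bigD1 (Ordinal km)) /=; last by rewrite gtn_eqF.
by rewrite sk subrr mul0r mulr0 eqxx.
Qed.

(* At a root [x > 0] of [lag m a], the relations [euler_lag] and [deriv_lag] give
   [x (a + 1 + m) lag m (a + 2) = (a + 1) (x + a) lag m (a + 1)]. *)
Lemma lag_interlaced_add2 m a : 0 < a -> interlaced m (lag m a) (lag m (a + 2%:R)).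
Proof.
move=> a0; have a1 : 0 < a + 1 by rewrite ltr_wpDr.
have a2 : 0 < a + 2 by rewrite ltr_wpDr.
have [s [[c0 cE] spos sinc]] := lag_simple m a1.
(* By [euler_lag] the polynomial of parameter [a] is an Euler image of that of parameter [a + 1], so
   the criterion [interlaced_euler_up] applies with [f = lag m (a + 2)]. *)
have aE : lag m a = (a^-1 * (lag m (a + 1))`_m) *: euler a 1 (root_prod m s).
  by rewrite -scalerA -euler_scale -cE euler_lag // scalerA mulVf ?scale1r // gt_eqF.
rewrite aE -[lag m (a + 2%:R)]scale1r; apply: interlaced_scale.
- by rewrite mulf_neq0 ?invr_neq0 // gt_eqF.
- exact: oner_neq0.
apply/strictly_interlacedW/interlaced_euler_up => //.
- by rewrite (leq_trans (size_poly _ _)) // size_root_prod.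
- by rewrite coef_lag_top invr_gt0 rising_gt0.
move=> x m0 x0 px rx.
have cpos : 0 < (lag m (a + 1))`_m by rewrite coef_lag_top invr_gt0 rising_gt0.
have pE : (root_prod m s).[x] = (lag m (a + 1)).[x] / (lag m (a + 1))`_m.
  by rewrite [X in _ = X.[x] / _]cE hornerZ mulrAC divff // mul1r.
have L0 : a * (lag m (a + 1)).[x] + x * (lag m (a + 1))^`().[x] = 0.
  by rewrite -[x * _]mul1r -horner_euler cE euler_scale hornerZ rx mulr0.
have := congr1 (horner^~ x) (deriv_lag m a1).
rewrite !hornerZ hornerD hornerN (_ : a + 1 + 1 = a + 2); last by ring.
move: px L0; rewrite pE; set L := (lag m (a + 1)).[x]; set D := _^`().[x].
set Q := (lag m (a + 2)).[x] => px L0 QE.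
have LN : L != 0 by apply: contraNneq px => ->; rewrite mul0r.
have xD : x * D = - (a * L) by apply/eqP; rewrite -addr_eq0 addrC L0.
have amp : 0 < a + 1 + m%:R by rewrite ltr_wpDr.
have E : (x * (a + 1 + m%:R)) * (Q * L) = (a + 1) * (x + a) * L ^+ 2.
  transitivity (((a + 1 + m%:R) * Q) * (x * L)); first by ring.
  rewrite QE; transitivity ((a + 1) * L * (x * L - x * D)); first by ring.
  by rewrite xD; ring.
rewrite mulrA pmulr_lgt0 ?invr_gt0 // -(pmulr_rgt0 _ (mulr_gt0 x0 amp)) E.
apply: mulr_gt0; last by rewrite exprn_even_gt0.
by apply: mulr_gt0 => //; exact: addr_gt0.
Qed.

(* The approximating products are compared by changing the factors [a + k + j] into
   [a + t + k + j] one at a time. *)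
Lemma lag_dominated m a t : 0 < a -> 0 < t -> dominated m (lag m a) (lag m (a + t)).
Proof.
move=> a0 t0; have at0 : 0 < a + t by rewrite addr_gt0.
set B := root_prod m (fun=> 1 : R).
have BB : interlaced m B B.
  apply: (@interlaced_refl _ _ _ (fun=> 1)) => //.
  by have := splits_root_prod m (fun=> 1 : R) (oner_neq0 R); rewrite scale1r.
have szB : (size B <= m.+1)%N by rewrite size_root_prod.
apply: (@dominated_closed _ m (fun M => multiplier (rising_approx a M) B)
   (fun M => multiplier (rising_approx (a + t) M) B)); last first.
- by rewrite coef_lag_top invr_neq0 // gt_eqF ?rising_gt0.
- by apply: (cvg_multiplier szB) => k _; exact: cvg_rising_approx.
- by rewrite coef_lag_top invr_neq0 // gt_eqF ?rising_gt0.
- by apply: (cvg_multiplier szB) => k _; exact: cvg_rising_approx.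
move=> M.
have E c : multiplier (rising_approx c M) B = (rising c M)^-1 *:
    multiplier (fun k => M.+1%:R^-1 ^+ k) (multiplier (fun k => rising (c + k%:R) M) B).
  apply/polyP => k; rewrite coefZ !coef_multiplier /rising_approx; ring.
rewrite !E; apply: dominated_scale; rewrite ?invr_neq0 ?gt_eqF ?rising_gt0 //.
apply: dominated_dilate; rewrite ?invr_gt0 //.
pose H i := multiplier (fun k => \prod_(j < M) ((if (j < i)%N then a + t else a) + k%:R + j%:R)) B.
have -> : multiplier (fun k => rising (a + k%:R) M) B = H 0%N by [].
have -> : multiplier (fun k => rising (a + t + k%:R) M) B = H M.
  by apply: (eq_multiplier szB) => k _; apply: eq_bigr => j _; rewrite ltn_ord.
have : (M <= M)%N by []; move: {1 3}M => i; elim: i => [|i IH] iM.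
  apply/interlaced_dominated; refine (preserves_prod _ _ BB) => j _.
  apply: (@preserves_eq _ _ (fun k => a + j%:R + k%:R)); first by move=> k _; rewrite ltn0; ring.
  by apply: preserves_up; rewrite ltr_wpDr.
apply: dominated_trans (IH (ltnW iM)) _; apply/interlaced_dominated.
(* [H i] and [H i.+1] differ in the factor of index [i] only: they are Euler images of one
   polynomial, with constants differing by [t]. *)
pose v k := \prod_(j < M | j != Ordinal iM) ((if (j < i)%N then a + t else a) + k%:R + j%:R).
have Pv : preserves m v.
  refine (preserves_prod _ _) => j _.
  apply: (@preserves_eq _ _ (fun k => (if (j < i)%N then a + t else a) + j%:R + k%:R)).
    by move=> k _; ring.
  by apply: preserves_up; rewrite ltr_wpDr //; case: ifP.
have -> : H i = euler (a + i%:R) 1 (multiplier v B).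
  rewrite -multiplier_euler multiplier_comp; apply: (eq_multiplier szB) => k _.
  by rewrite (bigD1 (Ordinal iM)) //= ltnn /v; congr (_ * _); ring.
have -> : H i.+1 = euler (a + t + i%:R) 1 (multiplier v B).
  rewrite -multiplier_euler multiplier_comp; apply: (eq_multiplier szB) => k _.
  rewrite (bigD1 (Ordinal iM)) //= ltnSn /v; congr (_ * _); first by ring.
  apply: eq_bigr => j ji; congr (_ + _ + _).
  by rewrite ltnS leq_eqVlt -[j == i :> nat]/(j == Ordinal iM) (negbTE ji).
apply: euler_up_weak_mono; [by rewrite ltr_wpDr | by rewrite ltrD2r ltrDl | exact: Pv].
Qed.

(** For [t < 2] a sandwich: the [k]-th root for [a + t] is at most the one for [a + 2], itself at
    most the root of index [k + 1] for [a]. *)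
Lemma lag_interlaced m a t : 0 < a -> 0 < t <= 2 -> interlaced m (lag m a) (lag m (a + t)).
Proof.
move=> a0 /andP[t0]; rewrite le_eqVlt => /predU1P[->|t2].
  exact: lag_interlaced_add2.
have at0 : 0 < a + t by rewrite addr_gt0.
have [s [u [Hs Hu su sinc uinc]]] := lag_dominated m a0 t0.
have := @lag_dominated m (a + t) (2 - t) at0; rewrite subr_gt0 => /(_ t2).
rewrite (_ : a + t + (2 - t) = a + 2); last by ring.
move=> [u' [v [Hu' Hv uv u'inc vinc]]].
have [s' [v' [Hs' Hv' sv vs]]] := lag_interlaced_add2 m a0.
have [s'inc v'inc] : (forall k, (k.+1 < m)%N -> s' k <= s' k.+1) /\
    (forall k, (k.+1 < m)%N -> v' k <= v' k.+1).
  split=> k km; have /andP[_ H1] := sv _ (ltnW km); have /andP[_ H2] := sv _ km.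
    exact: le_trans H1 (vs _ km).
  exact: le_trans (vs _ km) H2.
exists s, u; split=> // k km.
rewrite (splits_inj Hu Hu' uinc u'inc (ltnW km)) (splits_inj Hs Hs' sinc s'inc km).
have /andP[_ /le_trans -> //] := uv _ (ltnW km).
by rewrite (splits_inj Hv Hv' vinc v'inc (ltnW km)) vs.
Qed.

End Laguerre.

(** * The Gamma integral *)

Definition gamma_fun (R : realType) (p x : R) : R := x `^ p * expR (- x).

Definition gamma_int (R : realType) (p : R) : \bar R :=
  (\int[lebesgue_measure]_(x in `]0%R, +oo[) (gamma_fun p x)%:E)%E.

Section Gamma.
Variable R : realType.
Implicit Types p x a b : R.
Notation mu := (@lebesgue_measure R).

Lemma gamma_fun_ge0 p x : 0 <= gamma_fun p x.
Proof. by rewrite mulr_ge0 ?powR_ge0 ?expR_ge0. Qed.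

Lemma is_derive_gamma_fun p x : 0 < x ->
  is_derive x 1 (gamma_fun p) (p * gamma_fun (p - 1) x - gamma_fun p x).
Proof.
move=> x0; have dp := is_derive1_powR p x0.
rewrite /gamma_fun.
have de : is_derive x (1 : R) (fun y : R => expR (- y)) (- expR (- x)).
  apply: is_derive_eq. by rewrite mulrN1.
apply: (is_derive_eq (is_deriveM dp de)).
by rewrite /GRing.scale /=; ring.
Qed.

Lemma continuous_gamma_fun p x : 0 < x -> {for x, continuous (gamma_fun p)}.
Proof.
move=> x0; apply: differentiable_continuous; apply/derivable1_diffP.
by have [] := is_derive_gamma_fun p x0.
Qed.

Lemma within_continuous_gamma_fun p a b : 0 < a ->
  {within `[a, b], continuous (gamma_fun p)}.
Proof.
move=> a0; apply: continuous_in_subspaceT => x; rewrite inE /= in_itv /= => /andP[ax _].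
by apply: continuous_gamma_fun; apply: lt_le_trans ax.
Qed.

Lemma measurable_gamma_fun p D : measurable_fun D (gamma_fun p).
Proof.
apply: measurable_funTS; apply: measurable_funM; first exact: measurable_powR.
by apply: measurableT_comp => //; exact: oppr_measurable.
Qed.

Lemma integrable_gamma_fun_segment p a b : 0 < a ->
  mu.-integrable `[a, b] (EFin \o gamma_fun p).
Proof.
move=> a0; apply: continuous_compact_integrable; first exact: segment_compact.
exact: within_continuous_gamma_fun.
Qed.

(** The fundamental theorem of calculus for [gamma_fun p], on a segment away from 0 where all
    integrals are finite. *)
Lemma gamma_parts p a b : 0 < a -> a < b ->
  (p%:E * \int[mu]_(x in `[a, b]) (gamma_fun (p - 1) x)%:E =
   \int[mu]_(x in `[a, b]) (gamma_fun p x)%:E + (gamma_fun p b - gamma_fun p a)%:E)%E.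
Proof.
move=> a0 ab.
have Ip := integrable_gamma_fun_segment p b a0.
have Ip1 := integrable_gamma_fun_segment (p - 1) b a0.
have cf : {within `[a, b], continuous (fun x => p * gamma_fun (p - 1) x - gamma_fun p x)}.
  apply: continuous_in_subspaceT => x; rewrite inE /= in_itv /= => /andP[ax _].
  have x0 := lt_le_trans a0 ax.
  apply: cvgB; last exact: continuous_gamma_fun.
  by apply: cvgM; [exact: cvg_cst | exact: continuous_gamma_fun].
have dF : derivable_oo_LRcontinuous (gamma_fun p) a b.
  split.
  - move=> x; rewrite in_itv /= => /andP[ax _].
    by have [] := is_derive_gamma_fun p (lt_trans a0 ax).
  - exact/cvg_at_right_filter/continuous_gamma_fun.
  - exact/cvg_at_left_filter/continuous_gamma_fun/(lt_trans a0).
have eF : {in `]a, b[, (gamma_fun p)^`()%classic =1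
    (fun x => p * gamma_fun (p - 1) x - gamma_fun p x)}.
  move=> x; rewrite in_itv /= => /andP[ax _].
  by rewrite derive1E; have [_ ->] := is_derive_gamma_fun p (lt_trans a0 ax).
have := continuous_FTC2 ab cf dF eF.
have -> : (\int[mu]_(x in `[a, b]) (p * gamma_fun (p - 1) x - gamma_fun p x)%:E =
    p%:E * \int[mu]_(x in `[a, b]) (gamma_fun (p - 1) x)%:E
    - \int[mu]_(x in `[a, b]) (gamma_fun p x)%:E)%E.
  rewrite -integralZl //= -integralB_EFin //.
  exact: (integrableZl _ p Ip1).
have /fineK <- : (\int[mu]_(x in `[a, b]) (gamma_fun p x)%:E)%E \is a fin_num.
  exact: integrable_fin_num.
have /fineK <- : (\int[mu]_(x in `[a, b]) (gamma_fun (p - 1) x)%:E)%E \is a fin_num.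
  exact: integrable_fin_num.
rewrite -!EFinM -!EFinB -EFinD => E0; have E := EFin_inj E0; congr (_%:E).
by rewrite -E; move: (fine _) (fine _) => X Y; ring.
Qed.

Lemma cvg_gamma_int p :
  (\int[mu]_(x in `[n.+2%:R^-1%R, n.+2%:R%R]) (gamma_fun p x)%:E)%E @[n --> \oo]
    --> gamma_int p.
Proof.
rewrite /gamma_int.
have -> : `]0%R, +oo[%classic = \bigcup_n `[n.+2%:R^-1, n.+2%:R]%classic :> set R.
  apply/seteqP; split => [x|x [n _]] /=; rewrite !in_itv /= andbT; last first.
    by move=> /andP[+ _]; apply: lt_le_trans; rewrite invr_gt0.
  move=> x0; pose N := maxn (Num.bound x) (Num.bound x^-1).
  exists N => //=; rewrite in_itv /=.
  have bd (y : R) : 0 < y -> (Num.bound y <= N)%N -> y <= N.+2%:R.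
    move=> y0 yN; apply: le_trans (ltW (archi_boundP (ltW y0))) _.
    by rewrite ler_nat; apply: leq_trans yN (leqW (leqnSn _)).
  rewrite bd ?leq_maxl // andbT -[x]invrK lef_pV2 ?posrE ?invr_gt0 //.
  by apply: bd; rewrite ?invr_gt0 // leq_maxr.
apply: ge0_nondecreasing_set_cvg_integral.
- apply/nondecreasing_seqP => n; rewrite subsetEset => x /=; rewrite !in_itv /=.
  move=> /andP[nx xn]; rewrite (le_trans xn) ?ler_nat // andbT.
  by apply: le_trans nx; rewrite lef_pV2 ?posrE // ler_nat.
- by move=> n; exact: measurable_itv.
- by move=> n; apply/measurable_EFinP; exact: measurable_gamma_fun.
- by move=> n x _; rewrite lee_fin gamma_fun_ge0.
Qed.

Lemma cvg_gamma_fun_infty p : gamma_fun p n.+2%:R @[n --> \oo] --> (0 : R).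
Proof.
pose N := Num.bound `|p|.
have pN : p <= N%:R by rewrite (le_trans (ler_norm p)) // ltW // archi_boundP.
(* With [p <= N], the bound [exp x >= x^(N + 1) / (N + 1)!] gives [x^p exp (- x) <= (N + 1)! / x]
   for [x >= 1]. *)
apply: (@squeeze_cvgr _ _ _ _ (fun=> 0) (fun n => (N.+1)`!%:R * harmonic n)).
- apply: nearW => n; rewrite gamma_fun_ge0 /= /gamma_fun.
  have x1 : 1 <= n.+2%:R :> R by rewrite ler1n.
  have x0 : 0 < n.+2%:R :> R by [].
  apply: (@le_trans _ _ (n.+2%:R ^+ N * expR (- n.+2%:R))).
    by rewrite ler_wpM2r ?expR_ge0 // -powR_mulrn // ler_powR.
  rewrite expRN ler_pdivrMr ?expR_gt0 //.
  have : n.+2%:R ^+ N.+1 / N.+1`!%:R <= expR (n.+2%:R : R).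
    by apply: le_trans (expR_ge1Dxn N (ltW x0)); rewrite lerDr.
  rewrite ler_pdivrMr ?ltr0n ?fact_gt0 // mulrC => H.
  rewrite mulrAC; apply: (@le_trans _ _ (n.+2%:R ^+ N.+1 * harmonic n)).
    rewrite exprSr -mulrA ler_peMr ?exprn_ge0 ?(ltW x0) //.
    by rewrite /harmonic /= ler_pdivlMr // mul1r ler_nat.
  by rewrite ler_wpM2r // harmonic_ge0.
- exact: cvg_cst.
- rewrite -(mulr0 (N.+1`!%:R : R)); apply: cvgM; first exact: cvg_cst.
  exact: cvg_harmonic.
Qed.

Lemma cvg_gamma_fun_0 p : 0 < p -> gamma_fun p n.+2%:R^-1 @[n --> \oo] --> (0 : R).
Proof.
move=> p0.
have u0 : (n.+2%:R^-1 : R) @[n --> \oo] --> 0.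
  have := @cvg_harmonic R; rewrite -(cvg_shiftn 1) /=.
  by under eq_cvg do rewrite addn1.
have /cvg_at_rightP/(_ (fun n : nat => n.+2%:R^-1)) := powR_cvg0 p0.
have h : (forall n : nat, 0 < (n.+2%:R^-1 : R)) /\ (n.+2%:R^-1 : R) @[n --> \oo] --> 0.
  by split=> // n; rewrite invr_gt0.
move=> /(_ h); apply: squeeze_cvgr (cvg_cst 0).
apply: nearW => n; rewrite gamma_fun_ge0 /= /gamma_fun ler_piMr ?powR_ge0 //.
Qed.

(** The limit of [gamma_parts] along exhausting segments; [-1 < p] kills the boundary term at 0. The
    equality is in the extended reals because finiteness is later deduced from it. *)
Lemma gamma_intS p : -1 < p -> (gamma_int (p + 1) = (p + 1)%:E * gamma_int p)%E.
Proof.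
move=> p1; have p10 : 0 < p + 1 by rewrite -ltrBlDr sub0r.
pose J (q : R) (n : nat) : \bar R := (\int[mu]_(x in `[n.+2%:R^-1%R, n.+2%:R%R]) (gamma_fun q x)%:E)%E.
pose bdy (n : nat) : \bar R := (gamma_fun (p + 1) n.+2%:R - gamma_fun (p + 1) n.+2%:R^-1)%:E.
have bd : bdy n @[n --> \oo] --> 0%E.
  apply: cvg_EFin; first exact: nearW.
  rewrite -[0](subr0 0); apply: cvgB; first exact: cvg_gamma_fun_infty.
  exact: cvg_gamma_fun_0.
have L : (fun n => (p + 1)%:E * J p n)%E @ \oo --> ((p + 1)%:E * gamma_int p)%E.
  by apply: cvgeZl => //; exact: cvg_gamma_int.
have Rr : (fun n => J (p + 1)%R n + bdy n)%E
    @ \oo --> (gamma_int (p + 1) + 0)%E.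
  apply: cvgeD; [ | exact: cvg_gamma_int | exact: bd].
  by rewrite fin_num_adde_defl.
have E : (fun n => (p + 1)%:E * J p n)%E = (fun n => J (p + 1)%R n + bdy n)%E.
  apply/funext => n; rewrite /J /bdy -gamma_parts ?addrK ?invr_gt0 //.
  by rewrite (@lt_trans _ _ 1) ?invf_lt1 // ltr1n.
rewrite E adde0 in L Rr.
exact: (cvg_unique _ Rr L).
Qed.

Lemma gamma_int_ge0 p : (0 <= gamma_int p)%E.
Proof. by apply: integral_ge0 => x _; rewrite lee_fin gamma_fun_ge0. Qed.

Lemma gamma_int0_lty : (gamma_int (0 : R) < +oo)%E.
Proof.
have := @integral_exponential_pdf R 1 ltr01 => E.
apply: (@le_lt_trans _ _ (\int[mu]_x (exponential_pdf 1 x)%:E)%E).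
  2: by rewrite E ltry.
apply: (@le_trans _ _ (\int[mu]_(x in `]0%R, +oo[) (exponential_pdf 1 x)%:E)%E).
  apply: ge0_le_integral => //=.
  - by move=> x _; rewrite lee_fin gamma_fun_ge0.
  - by apply/measurable_EFinP; exact: measurable_gamma_fun.
  - apply/measurable_EFinP; apply: measurable_funTS. exact: measurable_exponential_pdf.
  move=> x; rewrite in_itv /= andbT => x0.
  by rewrite lee_fin (exponential_pdfE _ (ltW x0)) /gamma_fun powRr0 !mul1r mulN1r.
apply: ge0_subset_integral => //=.
- by apply/measurable_EFinP; exact: measurable_exponential_pdf.
- by move=> x _; rewrite lee_fin exponential_pdf_ge0.
Qed.

Lemma gamma_int_nat_lty n : (gamma_int (n%:R : R) < +oo)%E.
Proof.
elim: n => [|n IH]; first exact: gamma_int0_lty.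
rewrite -natr1 gamma_intS; last by rewrite (lt_le_trans (ltrN10 R)).
by apply: lte_mul_pinfty; rewrite ?lee_fin ?addr_ge0.
Qed.

(** For a nonnegative exponent [q <= N], [x^q <= 1 + x^N] reduces to natural exponents; in general
    the functional equation transfers finiteness from [p + 1] to [p]. *)
Lemma gamma_int_lty p : -1 < p -> (gamma_int p < +oo)%E.
Proof.
have pos (q : R) : 0 <= q -> (gamma_int q < +oo)%E.
  move=> q0; pose N := Num.bound q.
  have qN : q <= N%:R by rewrite ltW // archi_boundP.
  apply: (@le_lt_trans _ _ (gamma_int 0%R + gamma_int N%:R)%E); last first.
    by apply: lte_add_pinfty; [exact: gamma_int0_lty | exact: gamma_int_nat_lty].
  rewrite /gamma_int -ge0_integralD //=; first last.
  - by apply/measurable_EFinP; exact: measurable_gamma_fun.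
  - by move=> x _; rewrite lee_fin gamma_fun_ge0.
  - by apply/measurable_EFinP; exact: measurable_gamma_fun.
  - by move=> x _; rewrite lee_fin gamma_fun_ge0.
  apply: ge0_le_integral => //=.
  - by move=> x _; rewrite lee_fin gamma_fun_ge0.
  - by apply/measurable_EFinP; exact: measurable_gamma_fun.
  - apply: emeasurable_funD; apply/measurable_EFinP; exact: measurable_gamma_fun.
  move=> x; rewrite in_itv /= andbT => x0; rewrite -EFinD lee_fin /gamma_fun -mulrDl.
  rewrite ler_wpM2r ?expR_ge0 // powRr0.
  have [x1|x1] := leP 1 x; first by rewrite ler_wpDl ?ler_powR.
  rewrite ler_wpDr ?powR_ge0 // -[leRHS](powRr0 x).
  by apply: ger_powR => //; rewrite x0 ltW.
move=> p1; have p10 : 0 < p + 1 by rewrite -ltrBlDr sub0r.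
have := pos _ (ltW p10); rewrite gamma_intS //.
have := gamma_int_ge0 p; case: (gamma_int p) => [r _ _|_|//]; first exact: ltry.
by rewrite mulry gtr0_sg // mul1e.
Qed.

Lemma gamma_int_gt0 p : (0 < gamma_int p)%E.
Proof.
(* On [[1, 2]] the power is monotone, hence at least its smaller endpoint value, and the exponential
   is at least [expR (-2)]. *)
pose c : R := Num.min 1 (2 `^ p) * expR (-2).
have c0 : 0 < c by rewrite mulr_gt0 ?expR_gt0 // lt_min ltr01 powR_gt0.
apply: (@lt_le_trans _ _ (\int[mu]_(x in `[1%R, 2%R]) (cst c%:E x))%E).
  rewrite integral_cst //= lebesgue_measure_itv /= lte_fin ltr1n /= -EFinB.
  by rewrite -EFinM lte_fin mulr_gt0 // subr_gt0 ltr1n.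
apply: (@le_trans _ _ (\int[mu]_(x in `[1%R, 2%R]) (gamma_fun p x)%:E)%E).
  apply: ge0_le_integral => //=.
  - by move=> x _; rewrite lee_fin ltW.
  - by apply/measurable_EFinP; exact: measurable_gamma_fun.
  move=> x; rewrite in_itv /= => /andP[x1 x2]; rewrite lee_fin /gamma_fun.
  apply: ler_pM; rewrite ?expR_ge0 ?ler_expR ?lerN2 // ?le_min ?ler01 ?powR_ge0 //.
  have x0 : 0 < x by apply: lt_le_trans x1.
  rewrite ge_min; have [p0|p0] := leP 0 p.
    by rewrite -[leLHS](powRr0 x) ler_powR.
  rewrite orbC -[p]opprK !(powRN _ (- p)) lef_pV2 ?posrE ?powR_gt0 //.
  by rewrite ge0_ler_powR ?nnegrE ?oppr_ge0 // ltW.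
apply: ge0_subset_integral => //=.
- by apply/measurable_EFinP; exact: measurable_gamma_fun.
- by move=> x _; rewrite lee_fin gamma_fun_ge0.
- by move=> x /=; rewrite !in_itv /= andbT => /andP[x1 _]; apply: lt_le_trans x1.
Qed.

(* The value of the Gamma function at [p + 1]. *)
Definition Gamma1 p : R := fine (gamma_int p).

Lemma gamma_intE p : -1 < p -> gamma_int p = (Gamma1 p)%:E.
Proof.
move=> p1; rewrite fineK // ge0_fin_numE ?gamma_int_ge0 //.
exact: gamma_int_lty.
Qed.

Lemma Gamma1_gt0 p : -1 < p -> 0 < Gamma1 p.
Proof. by move=> p1; rewrite -lte_fin -gamma_intE // gamma_int_gt0. Qed.

Lemma Gamma1S p : -1 < p -> Gamma1 (p + 1) = (p + 1) * Gamma1 p.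
Proof.
move=> p1; apply: EFin_inj; rewrite EFinM -!gamma_intE ?gamma_intS //.
by rewrite (lt_trans p1) // ltrDl.
Qed.

Lemma gamma_fun_integrable p : -1 < p ->
  mu.-integrable `]0%R, +oo[ (EFin \o gamma_fun p).
Proof.
move=> p1; apply/integrableP; split.
  by apply/measurable_EFinP; exact: measurable_gamma_fun.
apply: le_lt_trans (gamma_int_lty p1); rewrite le_eqVlt; apply/orP; left; apply/eqP.
by apply: eq_integral => x _ /=; rewrite ger0_norm ?gamma_fun_ge0.
Qed.

End Gamma.

(** * Divided differences and moments *)

Section DividedDifferences.
Variables (R : realType) (T : finType) (node : T -> R).
Hypothesis node_inj : injective node.

Let basis t : {poly R} := \prod_(u | u != t) ('X - (node u)%:P).

(** The value at [node t] of the unnormalized Lagrange polynomial [basis t]; its inverse is the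
    coefficient in the divided difference. *)
Definition node_weight (t : T) : R := \prod_(u | u != t) (node t - node u).

Lemma node_weight_neq0 t : node_weight t != 0.
Proof.
apply/prodf_neq0 => u ut; rewrite subr_eq0; apply: contraNneq ut => /node_inj ->.
exact: eqxx.
Qed.

Let basisE t : basis t = \prod_(x <- map node (enum (predC1 t))) ('X - x%:P).
Proof. by rewrite big_map big_enum; apply: eq_bigl => u; rewrite inE. Qed.

Let size_basis t : size (basis t) = #|T|.
Proof.
rewrite basisE size_prod_XsubC size_map -cardE cardC1.
by rewrite prednK //; apply/card_gt0P; exists t.
Qed.

Let coef_basis t : (basis t)`_(#|T|.-1) = 1.
Proof.
have /monicP := monic_prod_XsubC (map node (enum (predC1 t))) xpredT id.
by rewrite -basisE lead_coefE size_basis.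
Qed.

Let horner_basis t u : (basis t).[node u] = (u == t)%:R * node_weight t.
Proof.
rewrite /basis horner_prod; case: eqVneq => [->|ut].
  by rewrite mul1r; apply: eq_bigr => v _; rewrite hornerXsubC.
by rewrite (bigD1 u) //= hornerXsubC subrr !mul0r.
Qed.

Let poly_eq0_nodes (p : {poly R}) :
  (size p <= #|T|)%N -> (forall t, p.[node t] = 0) -> p = 0.
Proof.
move=> sp p0; apply: (@roots_geq_poly_eq0 _ _ (map node (enum T))).
- by apply/allP => _ /mapP[t _ ->]; apply/rootP.
- by rewrite (map_inj_uniq node_inj) enum_uniq.
- by rewrite size_map -cardE.
Qed.

(** The top coefficient of the Lagrange interpolation formula. *)
Lemma divided_difference (p : {poly R}) : (size p <= #|T|)%N ->
  \sum_t (node_weight t)^-1 * p.[node t] = p`_(#|T|.-1).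
Proof.
move=> sp; have -> : p = \sum_t (p.[node t] / node_weight t) *: basis t.
  apply/eqP; rewrite -subr_eq0; apply/eqP/poly_eq0_nodes => [|u].
    rewrite (leq_trans (size_polyD _ _)) // geq_max sp size_polyN.
    apply: (leq_trans (size_sum _ _ _)); apply/bigmax_leqP => t _.
    by rewrite (leq_trans (size_scale_leq _ _)) // size_basis.
  rewrite hornerD hornerN horner_sum (bigD1 u) //= hornerZ horner_basis eqxx mul1r.
  rewrite divfK ?node_weight_neq0 // big1 ?addr0 ?subrr // => t tu.
  by rewrite hornerZ horner_basis eq_sym (negbTE tu) mul0r mulr0.
rewrite coef_sum; apply: eq_bigr => u _; rewrite coefZ coef_basis mulr1.
rewrite horner_sum (bigD1 u) //= hornerZ horner_basis eqxx mul1r.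
rewrite divfK ?node_weight_neq0 // big1 ?addr0 1?mulrC // => t tu.
by rewrite hornerZ horner_basis eq_sym (negbTE tu) mul0r mulr0.
Qed.

Definition rising_poly (m : nat) : {poly R} := \prod_(i < m) ('X + (i%:R)%:P).

Lemma horner_rising_poly m x : (rising_poly m).[x] = rising x m.
Proof. by rewrite horner_prod; apply: eq_bigr => i _; rewrite hornerD hornerX hornerC. Qed.

Lemma rising_polyE m : rising_poly m = root_prod m (fun i => - i%:R).
Proof. by apply: eq_bigr => i _; rewrite polyCN opprK. Qed.

(* The functional [p |-> \sum_t b t * p.[node t]] is determined by its values on the
   monic polynomials [rising_poly m] of all degrees [m < #|T|]. *)
Lemma divided_difference_unique (b : T -> R) :
  (forall m, (m.+2 <= #|T|)%N -> \sum_t b t * rising (node t) m = 0) ->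
  \sum_t b t * rising (node t) #|T|.-1 = 1 ->
  forall t, b t = (node_weight t)^-1.
Proof.
move=> b0 b1 t; have T0 : (0 < #|T|)%N by apply/card_gt0P; exists t.
have L k (p : {poly R}) : (k <= #|T|)%N -> (size p <= k)%N ->
    \sum_t b t * p.[node t] = p`_(#|T|.-1).
  elim: k p => [|k IH] p kT.
    rewrite leqn0 size_poly_eq0 => /eqP->; rewrite coef0 big1 // => u _.
    by rewrite horner0 mulr0.
  move=> sp; have [q sq [c ->]] : exists2 q : {poly R}, (size q <= k)%N &
      exists c, p = q + c *: rising_poly k.
    exists (p - p`_k *: rising_poly k); last by exists p`_k; rewrite subrK.
    apply/leq_sizeP => j; rewrite leq_eqVlt coefB coefZ rising_polyE => /predU1P[<-|kj].
      by rewrite coef_root_prod_top mulr1 subrr.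
    rewrite [p`_j]nth_default; last exact: leq_trans sp kj.
    by rewrite [(root_prod _ _)`_j]nth_default ?size_root_prod // mulr0 subr0.
  rewrite (eq_bigr (fun t => b t * q.[node t] + c * (b t * rising (node t) k))); last first.
    by move=> u _; rewrite hornerD hornerZ horner_rising_poly; ring.
  rewrite big_split /= -mulr_sumr (IH _ (ltnW kT) sq) coefD; congr (_ + _).
  rewrite coefZ; move: kT; rewrite leq_eqVlt => /predU1P[kT|kT].
    by rewrite -kT /= in b1 *; rewrite b1 rising_polyE coef_root_prod_top.
  rewrite b0 // rising_polyE nth_default // size_root_prod.
  by rewrite -ltnS prednK.
(* The Lagrange polynomial [basis t] vanishes at all other nodes and so isolates [b t]. *)
have := L _ (basis t) (leqnn _); rewrite size_basis coef_basis => /(_ (leqnn _)).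
rewrite (bigD1 t) //= horner_basis eqxx mul1r big1 ?addr0 => [|u ut]; last first.
  by rewrite horner_basis (negbTE ut) mul0r mulr0.
by move=> E; rewrite -[LHS](mulfK (node_weight_neq0 t)) E mul1r.
Qed.

End DividedDifferences.

(** * Moment conditions as a divided difference *)

Section Moments.
Variables (R : realType) (d : nat) (alpha : 'I_d -> R) (n : 'I_d -> nat).
Hypothesis alpha_gt : forall j, -1 < alpha j.
Hypothesis alpha_nint : forall j k, j != k -> alpha j - alpha k \isn't a Num.int.

Let T := {j : 'I_d & 'I_(n j)}.

Definition laguerre_node (t : {j : 'I_d & 'I_(n j)}) : R :=
  alpha (tag t) + (tagged t)%:R + 1.

Lemma card_nodes : #|{: T}| = multisize n.
Proof.
rewrite card_tagged sumnE big_map -[RHS]big_enum /=.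
by apply: eq_bigr => j _; rewrite card_ord.
Qed.

(** A coincidence between two blocks would make a difference of parameters an integer. *)
Lemma laguerre_node_inj : injective laguerre_node.
Proof.
move=> [j k] [j' k']; rewrite /laguerre_node /= => /addIr E.
have jj : j = j'.
  apply/eqP; apply: contraT => /alpha_nint/negP[].
  have -> : alpha j - alpha j' = k'%:R - k%:R.
    by apply/eqP; rewrite subr_eq addrAC -subr_eq opprK E addrC.
  by rewrite rpredB // natr_int.
case: j' / jj k' E => k' /addrI /eqP; rewrite eqr_nat => /eqP kk.
by congr existT; apply/val_inj.
Qed.

Lemma Gamma1_shift (p : R) k : -1 < p -> Gamma1 (p + k%:R) = Gamma1 p * rising (p + 1) k.
Proof.
move=> p1; elim: k => [|k IH]; first by rewrite addr0 /rising big_ord0 mulr1.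
rewrite -natr1 addrA Gamma1S ?IH ?risingS; first by ring.
by rewrite (lt_le_trans p1) // lerDl.
Qed.

(** The monomial of exponent [alpha_j + l + m] integrates to [Gamma (alpha_j + l + 1)] times the
    Pochhammer symbol of index [m] at the node. The moments are thus values of a functional carried
    by the nodes. *)
Lemma laguerre_momentE (A : {ffun 'I_d -> {poly R}}) m :
  (forall j, (size (A j) <= n j)%N) ->
  laguerre_moment alpha A m = (\sum_(t : {j : 'I_d & 'I_(n j)}) (A (tag t))`_(tagged t) *
    Gamma1 (alpha (tag t) + (tagged t)%:R) * rising (laguerre_node t) m)%:E.
Proof.
move=> szA; rewrite /laguerre_moment.
pose p (t : T) := alpha (tag t) + (tagged t)%:R.
have p1 t : -1 < p t by rewrite (lt_le_trans (alpha_gt (tag t))) // lerDl.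
have pm1 t : -1 < p t + m%:R by rewrite (lt_le_trans (p1 t)) // lerDl.
pose F (t : T) (x : R) : \bar R := (((A (tag t))`_(tagged t))%R%:E * (gamma_fun (p t + m%:R) x)%:E)%E.
transitivity (\int[lebesgue_measure]_(x in `]0%R, +oo[) (\sum_(t : {j : 'I_d & 'I_(n j)}) F t x))%E.
  apply: eq_integral => x; rewrite inE /= in_itv /= andbT => x0.
  rewrite /F; under eq_bigr do rewrite -EFinM; rewrite sumEFin; congr (_%:E).
  rewrite /laguerre_form mulr_suml.
  rewrite -(sig_big_dep xpredT (fun _ => xpredT) (fun j (l : 'I_(n j)) =>
    (A j)`_l * gamma_fun (alpha j + l%:R + m%:R) x)) /=.
  apply: eq_bigr => j _; rewrite (horner_coef_wide _ (szA j)) !mulr_suml.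
  apply: eq_bigr => l _; rewrite /gamma_fun.
  have xn : x != 0 by rewrite gt_eqF.
  rewrite !powRD ?xn ?implybT // !powR_mulrn ?ltW //; ring.
rewrite integral_sum //=; last first.
  by move=> t; apply: integrableZl => //; exact: gamma_fun_integrable.
rewrite -sumEFin; apply: eq_bigr => t _.
rewrite /F integralZl //; last exact: gamma_fun_integrable.
have -> : (\int[lebesgue_measure]_(x in `]0%R, +oo[) (gamma_fun (p t + m%:R) x)%:E)%E
  = (Gamma1 (p t + m%:R))%:E by rewrite -gamma_intE.
by rewrite -EFinM Gamma1_shift // mulrA.
Qed.

Definition typeI_coef (t : {j : 'I_d & 'I_(n j)}) : R :=
  (Gamma1 (alpha (tag t) + (tagged t)%:R) * node_weight laguerre_node t)^-1.

(** [typeI_laguerre] is a choice with a default, so existence has to come before any use of its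
    specification. *)
Lemma typeI_laguerre_exists : (0 < multisize n)%N ->
  exists A, typeI_laguerre_spec alpha n A.
Proof.
move=> N0.
(* [insub] turns [k < n j] into an ordinal; the default 0 is never read, the polynomial stopping at
   [n j]. *)
pose c j k : R := if insub k is Some l then typeI_coef (Tagged (fun j => 'I_(n j)) (l : 'I_(n j))) else 0.
pose A := [ffun j => \poly_(k < n j) c j k].
have szA j : (size (A j) <= n j)%N by rewrite ffunE size_poly.
have E m : laguerre_moment alpha A m =
    (\sum_t (node_weight laguerre_node t)^-1 * (rising_poly R m).[laguerre_node t])%:E.
  rewrite laguerre_momentE //; congr (_%:E); apply: eq_bigr => -[j l] _ /=.
  rewrite ffunE coef_poly ltn_ord /c valK /typeI_coef /= horner_rising_poly.
  congr (_ * _); rewrite invfM mulrAC mulVf ?mul1r //.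
  by rewrite gt_eqF // Gamma1_gt0 // (lt_le_trans (alpha_gt j)) // lerDl.
exists A; split=> // [m mN|]; rewrite E divided_difference ?card_nodes //;
  try exact: laguerre_node_inj; rewrite rising_polyE ?size_root_prod ?prednK //.
- by rewrite nth_default // size_root_prod -ltnS prednK.
- exact: ltnW.
- by rewrite coef_root_prod_top.
Qed.

Lemma typeI_laguerreP : (0 < multisize n)%N ->
  (forall j, (size (typeI_laguerre alpha n j) <= n j)%N) /\
  (forall j (l : 'I_(n j)), (typeI_laguerre alpha n j)`_l =
     typeI_coef (Tagged (fun j => 'I_(n j)) l)).
Proof.
move=> N0; have [A HA] := typeI_laguerre_exists N0.
have [szA mom0 mom1] : typeI_laguerre_spec alpha n (typeI_laguerre alpha n).
  by apply: (@xgetPex _ [ffun=> 0] [set A | typeI_laguerre_spec alpha n A]); exists A.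
split=> // j l.
have := @divided_difference_unique R _ laguerre_node laguerre_node_inj
  (fun t => (typeI_laguerre alpha n (tag t))`_(tagged t) * Gamma1 (alpha (tag t) + (tagged t)%:R)).
rewrite card_nodes => H.
have {}H := H _ _ (Tagged (fun j => 'I_(n j)) l).
rewrite /typeI_coef invfM mulrC -H /=.
- rewrite mulfK // gt_eqF // Gamma1_gt0 // (lt_le_trans (alpha_gt j)) // lerDl //.
- by move=> m mN; have := mom0 m mN; rewrite laguerre_momentE // => E; exact: (EFin_inj E).
- by move: mom1; rewrite laguerre_momentE // => E; exact: (EFin_inj E).
Qed.

End Moments.

(** * Type I multiple Laguerre polynomials *)

Section ClosedForm.
Variable R : realType.

(** Both sides are [m!]: the coefficient is [(-1)^(m - l)] times a binomial one, and the product is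
    [(-1)^(m - l) l! (m - l)!]. Consecutive [l] are compared. *)
Lemma integer_products m l : (l <= m)%N ->
  (root_prod m (fun=> 1 : R))`_l * \prod_(i < m.+1 | i != l :> nat) (l%:R - i%:R) =
  (root_prod m (fun=> 1 : R))`_0 * \prod_(i < m.+1 | i != 0%N :> nat) (0 - i%:R).
Proof.
elim: l => // l IH lm; rewrite -IH ?(ltnW lm) //.
set b := root_prod m _.
have lm0 : l%:R - m%:R != 0 :> R by rewrite subr_eq0 eqr_nat ltn_eqF.
have l10 : l.+1%:R != 0 :> R by rewrite pnatr_eq0.
have E : \prod_(i < m.+1 | i != l.+1 :> nat) (l.+1%:R - i%:R) * (l%:R - m%:R) =
    l.+1%:R * \prod_(i < m.+1 | i != l :> nat) (l%:R - i%:R) :> R.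
  rewrite big_mkcond big_ord_recl /= [in RHS]big_mkcond big_ord_recr /= gtn_eqF //= subr0.
  rewrite -!mulrA; congr (_ * (_ * _)); apply: eq_bigr => i _.
  by rewrite (_ : bump 0 i = i.+1) // eqSS -!natr1; case: ifP => // _; ring.
apply: (mulfI l10); apply: (mulIf lm0).
rewrite -[LHS]mulrA -[b`_l.+1 * _ * _]mulrA E mulrA coef_root_prod1S -/b.
by rewrite mulrA mulrA; ring.
Qed.

(** From [l] to [l + 1] the product gets multiplied by [(y + 1 + l) / (y + 1 + l - N)]; the
    telescoped identity is cleared of denominators. *)
Lemma shifted_products (N l : nat) (y : R) :
  \prod_(i < N) (y + l%:R - i%:R) * (falling (N%:R - (y + 1)) l * (-1) ^+ l) =
  \prod_(i < N) (y - i%:R) * rising (y + 1) l.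
Proof.
elim: l => [|l IH].
  rewrite /falling /rising !big_ord0 mulr1 !mulr1.
  by apply: eq_bigr => i _; rewrite addr0.
have E : (y + 1 + l%:R - N%:R) * \prod_(i < N) (y + l.+1%:R - i%:R) =
    (y + 1 + l%:R) * \prod_(i < N) (y + l%:R - i%:R).
  case: N {IH} => [|N]; first by rewrite !big_ord0 subr0.
  rewrite big_ord_recl [in RHS]big_ord_recr /=.
  rewrite (eq_bigr (fun i : 'I_N => y + l%:R - i%:R)); last first.
    by move=> i _; rewrite (_ : bump 0 i = i.+1) // -!natr1; ring.
  by rewrite -!natr1; ring.
rewrite risingS [RHS]mulrA -IH -[_ * _ * (y + 1 + l%:R)]mulrAC [_ * (y + 1 + _)]mulrC -E.
by rewrite /falling big_ord_recr /= exprS -/(falling _ _); ring.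
Qed.

(** Nodes in block [i] differ by integers and feed [integer_products]; the other blocks feed
    [shifted_products]. *)
Lemma node_weight_split (d : nat) (alpha : 'I_d -> R) (n : 'I_d -> nat) i (l : 'I_(n i)) :
  node_weight (@laguerre_node R d alpha n) (Tagged (fun j => 'I_(n j)) l) =
  \prod_(k < n i | k != l :> nat) (l%:R - k%:R) *
  \prod_(j | j != i) \prod_(k < n j) (alpha i - alpha j + l%:R - k%:R).
Proof.
rewrite /node_weight /laguerre_node /=.
rewrite -(sig_big_dep xpredT (fun j (k : 'I_(n j)) => Tagged (fun j => 'I_(n j)) k
    != Tagged (fun j => 'I_(n j)) l)
  (fun j (k : 'I_(n j)) => alpha i + l%:R + 1 - (alpha j + k%:R + 1))) /=.
rewrite (bigD1 i) //=; congr (_ * _).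
  by apply: eq_big => [k|k _]; [rewrite eq_Tagged | ring].
apply: eq_bigr => j ji; apply: eq_big => [k|k _]; last by ring.
by apply: contraNneq ji => /(congr1 (@tag _ _)) /= ->.
Qed.

(* With [c = alpha i - alpha j + 1], the Pochhammer symbol [(c - n j)_l] is
   [(-1) ^+ l * falling (n j - c) l]. *)
Definition jacobi_weight (d : nat) (alpha : 'I_d -> R) (n : 'I_d -> nat) (i : 'I_d)
    (l : nat) : R :=
  \prod_(j | j != i) (falling ((n j)%:R - (alpha i - alpha j + 1)) l /
    rising (alpha i - alpha j + 1) l).

(** Block [i] and the Gamma factor produce the Laguerre coefficients; each of the [r] other blocks
    produces a quotient of [jacobi_weight] and a sign [(-1) ^+ l], whence the dilation by
    [(-1) ^+ r]. *)
Lemma typeI_laguerreE r (alpha : 'I_r.+1 -> R) (n : 'I_r.+1 -> nat) i :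
  (forall j, -1 < alpha j) -> (forall j k, j != k -> alpha j - alpha k \isn't a Num.int) ->
  (forall j, (0 < n j)%N) -> (forall j, 0 < alpha i - alpha j + 1) ->
  exists2 c, c != 0 & typeI_laguerre alpha n i = c *:
    multiplier (fun l => ((-1) ^+ r) ^+ l)
      (multiplier (jacobi_weight alpha n i) (lag (n i).-1 (alpha i + 1))).
Proof.
move=> alpha_gt alpha_nint n_gt0 c_gt0.
have N0 : (0 < multisize n)%N.
  by rewrite /multisize (bigD1 i) //= ltn_addr // n_gt0.
have [szA coefA] := typeI_laguerreP alpha_gt alpha_nint N0.
set m := (n i).-1; have mE : m.+1 = n i by rewrite prednK.
set b := root_prod m (fun=> 1 : R).
pose D (l : nat) : R := \prod_(k < m.+1 | k != l :> nat) (l%:R - k%:R).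
pose E (j : 'I_r.+1) (l : nat) : R := \prod_(k < n j) (alpha i - alpha j + l%:R - k%:R).
have D0 l : D l != 0.
  by apply/prodf_neq0 => k kl; rewrite subr_eq0 eqr_nat eq_sym.
have E0 j l : j != i -> E j l != 0.
  rewrite eq_sym => /alpha_nint/negP ji; apply/prodf_neq0 => k _.
  apply/eqP => e0; apply: ji; have -> : alpha i - alpha j = k%:R - l%:R by lra.
  by rewrite rpredB // natr_int.
have b0 : b`_0 != 0 by exact: horner_root_prod1_0.
have P0 : \prod_(j | j != i) E j 0%N != 0 by apply/prodf_neq0 => j /E0.
(* The part of the denominator that is independent of [l], read off at [l = 0]. *)
exists ((Gamma1 (alpha i) * (b`_0 * D 0%N) * \prod_(j | j != i) E j 0%N)^-1).
  by rewrite invr_neq0 // !mulf_neq0 // ?gt_eqF ?Gamma1_gt0.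
apply/polyP => l; rewrite coefZ 2!coef_multiplier coef_lag -/m -/b.
have [ln|nl] := ltnP l (n i); last first.
  rewrite nth_default ?(leq_trans (szA i)) // [b`_l]nth_default ?mulr0 //.
  by rewrite size_root_prod mE.
have -> := coefA i (Ordinal ln); rewrite /typeI_coef node_weight_split /=.
rewrite Gamma1_shift //.
have -> : \prod_(k < n i | k != l :> nat) (l%:R - k%:R) = D l by rewrite /D mE.
have -> : \prod_(j | j != i) \prod_(k < n j) (alpha i - alpha j + l%:R - k%:R)
  = \prod_(j | j != i) E j l by [].
have bl : b`_l * D l = b`_0 * D 0%N by apply: integer_products; rewrite -ltnS mE.
have EE : (\prod_(j | j != i) E j l)^-1 =
    (\prod_(j | j != i) E j 0%N)^-1 * (((-1) ^+ r) ^+ l * jacobi_weight alpha n i l).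
  rewrite /jacobi_weight -!prodfV.
  have -> : ((-1) ^+ r) ^+ l = \prod_(j < r.+1 | j != i) (-1) ^+ l :> R.
    by rewrite prodr_const cardC1 card_ord /= -!exprM mulnC.
  rewrite -!big_split /=; apply: eq_bigr => j ji.
  have H := shifted_products (n j) l (alpha i - alpha j).
  have rn : rising (alpha i - alpha j + 1) l != 0 by rewrite gt_eqF ?rising_gt0.
  have e1 := E0 j l ji; have e2 := E0 j 0%N ji.
  have E00 : E j 0%N = \prod_(k < n j) (alpha i - alpha j - k%:R).
    by apply: eq_bigr => k _; rewrite addr0.
  move: H; rewrite -E00 -/(E j l) => H.
  apply: (mulfI e1); rewrite mulfV //; apply: (mulfI e2); apply: (mulIf rn).
  rewrite mulr1 -H; field; by rewrite e2 rn.
rewrite -bl !invfM EE.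
have g0 : Gamma1 (alpha i) != 0 by rewrite gt_eqF ?Gamma1_gt0.
have r0 : rising (alpha i + 1) l != 0.
  by rewrite gt_eqF // rising_gt0 // -ltrBlDr sub0r.
have bl0 : b`_l != 0.
  by apply: contra_neq (mulf_neq0 b0 (D0 0%N)) => bl0; rewrite -bl bl0 mul0r.
by field; rewrite g0 r0 bl0 P0 D0.
Qed.

End ClosedForm.

(** * Passage to zero sets, ordered lists of zeros and reflected polynomials *)

Section Conclusion.
Variable R : realType.
Implicit Types (m : nat) (s u : nat -> R) (p q : {poly R}).

Lemma ordered_zeros_mkseq m p s : splits m p s ->
  (forall k, (k.+1 < m)%N -> s k <= s k.+1) -> ordered_zeros p (mkseq s m).
Proof.
move=> Hs sinc; have [p0 pE] := Hs; split.
- by rewrite -size_poly_eq0 (splits_size Hs).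
- apply/(sortedP 0) => i; rewrite size_mkseq => im.
  by rewrite !nth_mkseq //; [exact: sinc | exact: ltnW].
- by rewrite lead_coefE (splits_size Hs) /= -root_prodE.
Qed.

Lemma interlacing_splits m p q s u : splits m p s -> splits m q u ->
  (forall k, (k < m)%N -> s k <= u k) -> (forall k, (k.+1 < m)%N -> u k <= s k.+1) ->
  interlacing p q.
Proof.
move=> Hs Hu su us; exists (mkseq s m), (mkseq u m); split.
- by apply: ordered_zeros_mkseq => // k km; apply: le_trans (us _ km); apply/su/ltnW.
- by apply: ordered_zeros_mkseq => // k km; apply: le_trans (us _ km) _; exact: su.
- by rewrite !size_mkseq.
- by move=> k; rewrite size_mkseq => km; rewrite !nth_mkseq //; exact: su.
- move=> k; rewrite size_mkseq => km.
  by rewrite !nth_mkseq //; [exact: us | exact: ltnW].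
Qed.

Lemma root_prod_rev m s : root_prod m (fun k => s (m - k.+1)%N) = root_prod m s.
Proof. by rewrite /root_prod [RHS](reindex_inj rev_ord_inj). Qed.

(** A dilation by -1; the indices are reversed to restore the increasing order. *)
Lemma splits_reflect m p s : splits m p s ->
  splits m (multiplier (fun k => (-1) ^+ k) p) (fun k => - s (m - k.+1)%N).
Proof.
move=> Hs; have m1 : -1 != 0 :> R by rewrite oppr_eq0 oner_eq0.
have [p0 pE] := splits_dilate m1 Hs; split=> //.
rewrite [LHS]pE; congr (_ *: _); rewrite -[LHS]root_prod_rev.
by apply: eq_root_prod => k _; rewrite invrN1 mulrN1.
Qed.

Lemma zeros_in_splits m p s (K : interval R) : splits m p s ->
  (forall k, (k < m)%N -> s k \in K) -> zeros_in m K p.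
Proof.
move=> Hs sK; split; first by rewrite (splits_size Hs).
move=> z; have [p0 ->] := Hs; rewrite root_prodE map_polyZ rmorph_prod /=.
rewrite (eq_bigr _ (fun x _ => map_polyXsubC _ x)) rootZ ?fmorph_eq0 //.
rewrite -(big_map (real_complex R) xpredT (fun y => 'X - y%:P)) root_prod_XsubC.
move=> /mapP[x /mapP[k + ->] ->]; rewrite mem_iota => km.
by exists (s k) => //; exact: sK.
Qed.

Lemma interlacing_interlaced m p q : interlaced m p q -> interlacing p q.
Proof.
move=> [s [u [Hs Hu su us]]]; apply: interlacing_splits Hs Hu _ us.
by move=> k /su/andP[].
Qed.

(** Reflection reverses the order of the roots, so [p] and [q] exchange places: hence the two
    parities of the theorem. *)
Lemma interlacing_reflect m p q a b : a != 0 -> b != 0 -> interlaced m p q ->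
  interlacing (b *: multiplier (fun k => (-1) ^+ k) q) (a *: multiplier (fun k => (-1) ^+ k) p).
Proof.
move=> a0 b0 [s [u [Hs Hu su us]]].
apply: (interlacing_splits (splits_scale b0 (splits_reflect Hu))
  (splits_scale a0 (splits_reflect Hs))) => k km; rewrite lerN2.
  have /su/andP[] // : (m - k.+1 < m)%N by rewrite ltn_subrL; case: (m) km.
have E : (m - k.+1 = (m - k.+2).+1)%N by rewrite -subSS subSn.
by rewrite E; apply: us; rewrite -E ltn_subrL; case: (m) km.
Qed.

Lemma multiplier_one p : multiplier (fun k => 1 ^+ k) p = p.
Proof. by apply/polyP => k; rewrite coef_multiplier expr1n mul1r. Qed.

Lemma preserves_jacobi_weight m d (alpha : 'I_d -> R) (n : 'I_d -> nat) i :
  (forall j, 0 < alpha i - alpha j + 1) ->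
  (forall j, m%:R - 1 < (n j)%:R - (alpha i - alpha j + 1)) ->
  preserves m (jacobi_weight alpha n i).
Proof.
move=> c_gt0 e_gt; refine (preserves_prod _ _) => j _.
by refine (preserves_mul _ _); [exact: preserves_falling | exact: preserves_rising].
Qed.

Lemma jacobi_weight0 d (alpha : 'I_d -> R) (n : 'I_d -> nat) i :
  jacobi_weight alpha n i 0 = 1.
Proof.
rewrite /jacobi_weight big1 // => j _.
by rewrite /falling /rising !big_ord0 divr1.
Qed.

(** Only differences of parameters enter, so the shift by [t] acts on the Laguerre factor alone. *)
Lemma jacobi_weight_shift d (alpha : 'I_d -> R) (n : 'I_d -> nat) i t :
  jacobi_weight (shift_params alpha t) n i = jacobi_weight alpha n i.
Proof.
apply/funext => l; apply: eq_bigr => j _; rewrite /shift_params.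
by rewrite (_ : alpha i + t - (alpha j + t) = alpha i - alpha j) //; ring.
Qed.

End Conclusion.

(* The number of weights is r.+1, so alpha ord0 is the first entry of alpha. *)
Theorem theorem4p5 (R : realType) (r : nat)
    (alpha : 'I_r.+1 -> R) (n : 'I_r.+1 -> nat) (i : 'I_r.+1)
    (alpha_decr : forall j k : 'I_r.+1, (j < k)%N -> alpha k < alpha j)
    (alpha_gt : -1 < alpha ord_max)
    (alpha_nint : forall j k : 'I_r.+1, j != k ->
      alpha j - alpha k \isn't a Num.int)
    (n_gt0 : forall j : 'I_r.+1, (0 < n j)%N)
    (alphai_gt : alpha ord0 - 1 < alpha i)
    (alphai_lt : alpha i < min_sum alpha n - (n i)%:R + 1) :
  zeros_in (n i).-1 (Delta R r.+1) (typeI_laguerre alpha n i) /\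
  (forall t : R, 0 < t <= 2 ->
    (~~ odd r.+1 ->
      interlacing (typeI_laguerre (shift_params alpha t) n i)
                  (typeI_laguerre alpha n i)) /\
    (odd r.+1 ->
      interlacing (typeI_laguerre alpha n i)
                  (typeI_laguerre (shift_params alpha t) n i))).
Proof.
have alpha_gt' j : -1 < alpha j.
  have [jr|rj] := ltnP j r; first exact: lt_trans alpha_gt (alpha_decr j ord_max jr).
  by rewrite (_ : j = ord_max) //; apply/val_inj/anti_leq; rewrite /= rj -ltnS ltn_ord.
have alpha_le0 j : alpha j <= alpha ord0.
  have [j0|] := posnP j; first by rewrite (_ : j = ord0) //; apply/val_inj.
  by move=> j0; apply/ltW/alpha_decr.
(* As [alpha ord0] is the largest parameter, [alphai_gt] makes the base of every Pochhammer
   denominator positive. *)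
have c_gt0 j : 0 < alpha i - alpha j + 1 by have := alpha_le0 j; lra.
set m := (n i).-1; set W := jacobi_weight alpha n i; set a := alpha i + 1.
have a0 : 0 < a by have := alpha_gt' i; rewrite /a; lra.
have mE : m%:R = (n i)%:R - 1 :> R by rewrite -[in RHS](prednK (n_gt0 i)) -natr1 addrK.
have PW : preserves m W.
  (* For each [j], [alphai_lt] amounts to [n_j - (alpha_i - alpha_j + 1) > n_i - 2 = m - 1]. *)
  apply: preserves_jacobi_weight => // j.
  have : min_sum alpha n <= alpha j + (n j)%:R by apply: bigmin_le.
  by move: alphai_lt; rewrite mE; lra.
pose P x := multiplier W (lag m x).
have PP : interlaced m (P a) (P a) by exact/PW/lag_interlaced_refl.
(* Both multipliers are 1 at index 0, so the constant coefficient is that of [(X - 1)^m] and 0 is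
   not a root. *)
have [s [Hs spos]] : exists s, splits m (P a) s /\ forall k, (k < m)%N -> 0 < s k.
  have [s [u [Hs _ su _ _]]] := interlaced_dominated PP.
  exists s; split=> // k km; have /andP[s0 _] := su _ km.
  rewrite lt_neqAle s0 andbT; apply/eqP => sk.
  have := splits_root Hs km; rewrite -sk horner_coef0 /P coef_multiplier coef_lag.
  rewrite /W jacobi_weight0 /rising big_ord0 invr1 !mul1r => /eqP.
  by rewrite (negbTE (horner_root_prod1_0 _ _)).
have AE : exists2 c, c != 0 & typeI_laguerre alpha n i =
    c *: multiplier (fun l => ((-1) ^+ r) ^+ l) (P a) by exact: typeI_laguerreE.
have AtE t : 0 < t -> exists2 c, c != 0 & typeI_laguerre (shift_params alpha t) n i =
    c *: multiplier (fun l => ((-1) ^+ r) ^+ l) (P (a + t)).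
  move=> t0; have [j|j k jk|//|j|c' c'0 E] := @typeI_laguerreE R r (shift_params alpha t) n i.
  - by rewrite /shift_params; have := alpha_gt' j; lra.
  - rewrite /shift_params (_ : alpha j + t - (alpha k + t) = alpha j - alpha k); last by ring.
    exact: alpha_nint.
  - by rewrite /shift_params; have := c_gt0 j; lra.
  exists c' => //; rewrite E jacobi_weight_shift /P /shift_params.
  by rewrite (_ : alpha i + t + 1 = a + t) // /a; ring.
have Pt t : 0 < t <= 2 -> interlaced m (P a) (P (a + t)).
  by move=> t02; exact/PW/lag_interlaced.
(* Only the closed forms matter from here on, so the polynomials themselves are generalized. *)
suff concl (A : {poly R}) (At : R -> {poly R}) :
    (exists2 c, c != 0 & A = c *: multiplier (fun l => ((-1) ^+ r) ^+ l) (P a)) ->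
    (forall t, 0 < t -> exists2 c, c != 0 &
      At t = c *: multiplier (fun l => ((-1) ^+ r) ^+ l) (P (a + t))) ->
    zeros_in m (Delta R r.+1) A /\ (forall t, 0 < t <= 2 ->
      (~~ odd r.+1 -> interlacing (At t) A) /\ (odd r.+1 -> interlacing A (At t))).
  exact: (concl _ (fun t => typeI_laguerre (shift_params alpha t) n i) AE AtE).
move=> [c c0 ->] {AE} {}AtE; rewrite /Delta oddS.
(* The number of weights is [r.+1]: odd [r] is the case of an even number, where the roots are
   reflected to the negative axis. *)
have [ro|re] : odd r \/ ~~ odd r by case: (odd r); [left | right].
  have sgE : (-1) ^+ r = -1 :> R by rewrite -signr_odd ro expr1.
  rewrite ro sgE in AtE *; split.
    apply: zeros_in_splits (splits_scale c0 (splits_reflect Hs)) _ => k km.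
    by rewrite /= in_itv /= oppr_lt0; apply: spos; rewrite ltn_subrL; case: (m) km.
  move=> t t02; split=> // _; have [c' c'0 ->] := AtE t (proj1 (andP t02)).
  exact: interlacing_reflect (Pt t t02).
have sgE : (-1) ^+ r = 1 :> R by rewrite -signr_odd (negbTE re) expr0.
rewrite re sgE multiplier_one in AtE *; split.
  apply: zeros_in_splits (splits_scale c0 Hs) _ => k km.
  by rewrite /= in_itv /= spos.
move=> t t02; split=> // _; have [c' c'0 ->] := AtE t (proj1 (andP t02)).
rewrite multiplier_one; apply: interlacing_interlaced.
exact: interlaced_scale (Pt t t02).
Qed.
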